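(* Let $(V,F^\bullet,\theta)$ be a distinguished local strongly parabolic Higgs bundle. Then it induces a principal $\tilde A$-module structure on $V$: the $A$-module structure on $V$ given by letting $\lambda$ act as $\theta$ extends to an $\tilde A$-module structure for which $V$ is free of rank one over $\tilde A$.
   Context: $k$ is an algebraically closed field and $\mathcal O=k[[t]]$. A local strongly parabolic Higgs bundle is a triple $(V,F^\bullet,\theta)$ where: (a) $V$ is a free $\mathcal O$-module of rank $r$ with a filtration by $\mathcal O$-submodules $V=V^0\supset V^1\supset\dots\supset V^\sigma=tV$, $\dim_kV^i/V^{i+1}=m_{i+1}>0$; let $n_1\ge\dots\ge n_\sigma$ be the decreasing rearrangement of $(m_i)$, a partition of $r$, and $\mu_i=\#\{\ell:n_\ell\ge i\}$ ($1\le i\le n_1$) the conjugate partition; (b) $\theta:V\to V$ is $\mathcal O$-linear with $\theta(V^i)\subset V^{i+1}$ for $0\le i<\sigma$. It is distinguished if moreover (c): the characteristic polynomial $f(\lambda,t)$ of $\theta$ factors as $f=\prod_{i=1}^{n_1}f_i$, where each $f_i\in k[[t]][\lambda]$ is an Eisenstein polynomial (monic, all non-leading coefficients divisible by $t$, constant term of $t$-valuation exactly $1$) of degree $\mu_i$, and whenever $i\neq j$ and $\deg f_i=\deg f_j$ the difference of the constant terms of $f_i$ and $f_j$ lies in $t\,k[[t]]\setminus t^2k[[t]]$. Put $A=\mathcal O[\lambda]/(f)$, $A_i=\mathcal O[\lambda]/(f_i)$ (a discrete valuation ring) and $\tilde A=\prod_{i=1}^{n_1}A_i$, so there is a natural injection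 $A\hookrightarrow\tilde A$ making $\tilde A$ the normalization of $A$. A principal $\tilde A$-module is a free $\tilde A$-module of rank one. *)

(* Defs.v *)
From HB Require Import structures.
From mathcomp Require Import all_boot all_order all_algebra qpoly.
From mathcomp Require Import boolp.

Set Implicit Arguments.
Unset Strict Implicit.
Unset Printing Implicit Defensive.

Import GRing.Theory.
Local Open Scope ring_scope.

(******************************************************************************)
(*      {fps R} == the ring R[[t]] of formal power series over R              *)
(*          a n == the coefficient of t^n in a                                *)
(*       fpsC c == the constant series c                                      *)
(*         fpsT == the variable t                                             *)
(******************************************************************************)

Record fps (R : Type) := Fps { fps_coef :> nat -> R }.

Reserved Notation "{ 'fps' R }" (format "{ 'fps'  R }").
Notation "{ 'fps' R }" := (fps R) : type_scope.

HB.instance Definition _ (R : Type) := [isNew for @fps_coef R].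
HB.instance Definition _ (R : choiceType) := [Choice of {fps R} by <:].

Section FpsRing.
Variable R : comNzRingType.
Implicit Types (a b c : {fps R}).

Lemma fpsP a b : (forall n, a n = b n) <-> a = b.
Proof.
split=> [ab|->//]; case: a b ab => [a] [b] /= ab; congr Fps; exact/funext.
Qed.

Definition fps_zero : {fps R} := Fps (fun=> 0).
Definition fps_opp a : {fps R} := Fps (fun n => - a n).
Definition fps_add a b : {fps R} := Fps (fun n => a n + b n).
Definition fps_mul a b : {fps R} :=
  Fps (fun n => \sum_(i < n.+1) a i * b (n - i)%N).
Definition fpsC (c : R) : {fps R} := Fps (fun n => c *+ (n == 0)%N).
Definition fpsT : {fps R} := Fps (fun n => (n == 1)%N%:R).

Fact fps_addA : associative fps_add.
Proof. by move=> a b c; apply/fpsP => n /=; rewrite addrA. Qed.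
Fact fps_addC : commutative fps_add.
Proof. by move=> a b; apply/fpsP => n /=; rewrite addrC. Qed.
Fact fps_add0 : left_id fps_zero fps_add.
Proof. by move=> a; apply/fpsP => n /=; rewrite add0r. Qed.
Fact fps_addN : left_inverse fps_zero fps_opp fps_add.
Proof. by move=> a; apply/fpsP => n /=; rewrite addNr. Qed.

HB.instance Definition _ :=
  GRing.isZmodule.Build {fps R} fps_addA fps_addC fps_add0 fps_addN.

Definition fps_trunc N a : {poly R} := \poly_(i < N) a i.

Lemma fps_mul_trunc N a b n : (n < N)%N ->
  (fps_mul a b) n = (fps_trunc N a * fps_trunc N b)`_n.
Proof.
move=> nN; rewrite coefM /=; apply: eq_bigr => -[i /= ilen] _.
rewrite !coef_poly (leq_trans _ nN) ?ltnS //.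
have -> : (n - i < N)%N := leq_ltn_trans (leq_subr i n) nN.
by [].
Qed.

Lemma fps_coefM_eq (p p' q q' : {poly R}) n :
  (forall i, (i <= n)%N -> p`_i = p'`_i) ->
  (forall i, (i <= n)%N -> q`_i = q'`_i) -> (p * q)`_n = (p' * q')`_n.
Proof.
move=> pp' qq'; rewrite !coefM; apply: eq_bigr => -[i /= ilen] _.
by rewrite pp' // qq' // leq_subr.
Qed.

Lemma fps_truncM N a b i : (i < N)%N ->
  (fps_trunc N (fps_mul a b))`_i = (fps_trunc N a * fps_trunc N b)`_i.
Proof. by move=> iN; rewrite coef_poly iN (fps_mul_trunc _ _ iN). Qed.

Fact fps_mulA : associative fps_mul.
Proof.
move=> a b c; apply/fpsP => n; rewrite !(@fps_mul_trunc n.+1) //.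
transitivity ((fps_trunc n.+1 a * (fps_trunc n.+1 b * fps_trunc n.+1 c))`_n).
  by apply: fps_coefM_eq => // i ilen; rewrite fps_truncM.
rewrite mulrA; apply: fps_coefM_eq => // i ilen.
by rewrite fps_truncM.
Qed.

Fact fps_mulC : commutative fps_mul.
Proof.
by move=> a b; apply/fpsP => n; rewrite !(@fps_mul_trunc n.+1) // mulrC.
Qed.

Fact fps_mul1 : left_id (fpsC 1) fps_mul.
Proof.
move=> a; apply/fpsP => n /=.
rewrite big_ord_recl /= mul1r subn0 big1 ?addr0 // => i _.
by rewrite mul0r.
Qed.

Fact fps_mulD : left_distributive fps_mul +%R.
Proof.
move=> a b c; apply/fpsP => n /=; rewrite -big_split /=.
by apply: eq_bigr => i _; rewrite mulrDl.
Qed.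

Fact fps_oner_neq0 : fpsC 1 != 0.
Proof. by apply/eqP => /fpsP/(_ 0)/eqP /=; rewrite oner_eq0. Qed.

HB.instance Definition _ := GRing.Zmodule_isComNzRing.Build {fps R}
  fps_mulA fps_mulC fps_mul1 fps_mulD fps_oner_neq0.

Definition fps_dvdT (n : nat) a : Prop := exists b, a = fpsT ^+ n * b.

Definition fps_has_val a (n : nat) : Prop := fps_dvdT n a /\ ~ fps_dvdT n.+1 a.

Record eisenstein (p : {poly {fps R}}) : Prop := {
  eisenstein_monic : p \is monic;
  eisenstein_dvd : forall i, (i < (size p).-1)%N -> fps_dvdT 1%N p`_i;
  eisenstein_val : fps_has_val p`_0 1%N
}.

End FpsRing.

Arguments fpsT {R}.

(* The product of a (possibly empty, hence possibly trivial) family of rings. *)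
Definition prod_ring (I : Type) (T : I -> comPzRingType) := forall i, T i.

Section ProdRing.
Variables (I : Type) (T : I -> comPzRingType).
Local Notation P := (prod_ring T).
Implicit Types x y : P.

HB.instance Definition _ := Choice.copy P (forall i, (T i : choiceType)).

Definition pr_zero : P := fun=> 0.
Definition pr_one : P := fun=> 1.
Definition pr_opp x : P := fun i => - x i.
Definition pr_add x y : P := fun i => x i + y i.
Definition pr_mul x y : P := fun i => x i * y i.

Fact pr_addA : associative pr_add.
Proof. by move=> x y z; apply/functional_extensionality_dep => i; apply: addrA. Qed.
Fact pr_addC : commutative pr_add.
Proof. by move=> x y; apply/functional_extensionality_dep => i; apply: addrC. Qed.
Fact pr_add0 : left_id pr_zero pr_add.
Proof. by move=> x; apply/functional_extensionality_dep => i; apply: add0r. Qed.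
Fact pr_addN : left_inverse pr_zero pr_opp pr_add.
Proof. by move=> x; apply/functional_extensionality_dep => i; apply: addNr. Qed.

HB.instance Definition _ :=
  GRing.isZmodule.Build P pr_addA pr_addC pr_add0 pr_addN.

Fact pr_mulA : associative pr_mul.
Proof. by move=> x y z; apply/functional_extensionality_dep => i; apply: mulrA. Qed.
Fact pr_mulC : commutative pr_mul.
Proof. by move=> x y; apply/functional_extensionality_dep => i; apply: mulrC. Qed.
Fact pr_mul1 : left_id pr_one pr_mul.
Proof. by move=> x; apply/functional_extensionality_dep => i; apply: mul1r. Qed.
Fact pr_mulD : left_distributive pr_mul +%R.
Proof. by move=> x y z; apply/functional_extensionality_dep => i; apply: mulrDl. Qed.

HB.instance Definition _ := GRing.Zmodule_isComPzRing.Build P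
  pr_mulA pr_mulC pr_mul1 pr_mulD.

End ProdRing.

(* R[X]/(f_0) x ... x R[X]/(f_(n-1)); the quotients {poly %/ f_i} have their  *)
(* usual meaning when the f_i are monic of positive degree.                   *)
Definition prod_qpoly (R : comNzRingType) n (f_ : 'I_n -> {poly R}) :=
  prod_ring (fun i => {poly %/ f_ i} : comPzRingType).

HB.instance Definition _ (R : comNzRingType) n (f_ : 'I_n -> {poly R}) :=
  GRing.ComPzRing.on (prod_qpoly f_).

(* The canonical map R[X]/(f) -> prod_i R[X]/(f_i), on reduced                *)
(* representatives; see to_prod_qpolyE.                                       *)
Definition to_prod_qpoly (R : comNzRingType) (f : {poly R}) n
    (f_ : 'I_n -> {poly R}) (a : {poly %/ f}) : prod_qpoly f_ :=
  fun i => in_qpoly (f_ i) (a : {poly R}).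

Lemma to_prod_qpolyE (R : comNzRingType) (f : {poly R}) n
    (f_ : 'I_n -> {poly R}) (p : {poly R}) :
  (forall i, f_ i \is monic /\ (1 < size (f_ i))%N) -> f = \prod_(i < n) f_ i ->
  to_prod_qpoly f_ (in_qpoly f p) = (fun i => in_qpoly (f_ i) p).
Proof.
move=> f_mon ef; apply/functional_extensionality_dep => i.
have f_mk : mk_monic (f_ i) = f_ i by case: (f_mon i) => m s; rewrite /mk_monic m s.
have fmon : f \is monic by rewrite ef monic_prod // => j _; case: (f_mon j).
have fE : f = f_ i * \prod_(j < n | j != i) f_ j by rewrite ef (bigD1 i).
have qmon : \prod_(j < n | j != i) f_ j \is monic.
  by rewrite monic_prod // => j _; case: (f_mon j).
case: (f_mon i) => fim fis; move: (\prod_(j < n | _) _) fE qmon => q fE qmon.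
have sf : (1 < size f)%N.
  rewrite fE size_Mmonic ?monic_neq0 //.
  have := monic_neq0 qmon; rewrite -size_poly_gt0.
  by case: (size q) => // s _; rewrite addnS (ltn_addr _ fis).
rewrite /to_prod_qpoly /=.
have {2}-> : p = Pdiv.CommonRing.rdivp p f * f + Pdiv.CommonRing.rmodp p f.
  exact: (Pdiv.RingMonic.rdivp_eq fmon).
rewrite raddfD /= rmorphM /=.
have -> : in_qpoly (f_ i) f = 0.
  apply/val_inj => /=; rewrite f_mk fE mulrC.
  by rewrite Pdiv.RingMonic.rmodp_mull.
by rewrite mulr0 add0r /mk_monic fmon sf.
Qed.

Definition is_basis (R : pzRingType) (V : lmodType R) (r : nat)
    (e : 'I_r -> V) : Prop :=
  forall v, exists! c : 'rV[R]_r, v = \sum_i c 0 i *: e i.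

Definition free_of_rank (R : pzRingType) (V : lmodType R) (r : nat) : Prop :=
  exists e : 'I_r -> V, is_basis e.

(* f is the characteristic polynomial of the endomorphism theta of the free   *)
(* module V of rank r; it does not depend on the basis e.                     *)
Definition is_char_poly (R : comNzRingType) (V : lmodType R) (r : nat)
    (theta : V -> V) (f : {poly R}) : Prop :=
  exists e : 'I_r -> V, is_basis e /\
  exists M : 'M[R]_r,
    (forall j, theta (e j) = \sum_i M i j *: e i) /\ f = char_poly M.

(* dim_k U / W = d: some b_0, ..., b_(d-1) in U form a k-basis modulo W.      *)
Definition quo_dim (k : fieldType) (V : lmodType {fps k}) (U W : {pred V})
    (d : nat) : Prop :=
  exists b : 'I_d -> V, (forall i, b i \in U) /\
  forall u, u \in U ->
    exists! c : 'rV[k]_d, u - \sum_i fpsC (c 0 i) *: b i \in W.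

(* The filtration V = F 0 > F 1 > ... > F sigma = tV; the values of F beyond  *)
(* sigma are irrelevant, and tnth m i is m_{i+1} = dim F i / F i.+1.          *)
Record parabolic_filtration (k : fieldType) (V : lmodType {fps k})
    (sigma : nat) (m : sigma.-tuple nat) (F : nat -> {pred V}) : Prop := {
  filt_submod : forall i, (i <= sigma)%N -> submod_closed (F i);
  filt_first : F 0%N =i predT;
  filt_last : forall v, v \in F sigma <-> exists w, v = fpsT *: w;
  filt_sub : forall i, (i < sigma)%N -> {subset F i.+1 <= F i};
  filt_dim : forall i : 'I_sigma, quo_dim (F i) (F i.+1) (tnth m i);
  filt_pos : forall i : 'I_sigma, (0 < tnth m i)%N
}.

Record strongly_parabolic_Higgs (k : fieldType) (V : lmodType {fps k})
    (r sigma : nat) (m : sigma.-tuple nat) (F : nat -> {pred V})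
    (theta : {linear V -> V}) : Prop := {
  Higgs_free : free_of_rank V r;
  Higgs_filt : parabolic_filtration m F;
  Higgs_field : forall i, (i < sigma)%N ->
    forall v, v \in F i -> theta v \in F i.+1
}.

Definition partition_of sigma (m : sigma.-tuple nat) : seq nat := sort geq m.

Definition largest_part sigma (m : sigma.-tuple nat) : nat :=
  head 0%N (partition_of m).

Definition conj_part sigma (m : sigma.-tuple nat) (i : nat) : nat :=
  count (fun n => i <= n)%N (partition_of m).

(* Indices start at 0, so that f_ i is the factor of degree mu_{i+1}.         *)
Record distinguished (k : fieldType) (V : lmodType {fps k})
    (r sigma : nat) (m : sigma.-tuple nat) (theta : {linear V -> V})
    (f : {poly {fps k}}) (f_ : 'I_(largest_part m) -> {poly {fps k}}) : Prop := {
  dist_char : is_char_poly r theta f;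
  dist_prod : f = \prod_i f_ i;
  dist_eisenstein : forall i, eisenstein (f_ i);
  dist_size : forall i, size (f_ i) = (conj_part m i.+1).+1;
  dist_coef0 : forall i j, i != j -> size (f_ i) = size (f_ j) ->
    fps_has_val ((f_ i)`_0 - (f_ j)`_0) 1%N
}.

(* A left R-module structure on an existing abelian group V: the data of the  *)
(* factory GRing.Zmodule_isLmodule R V, as a type one can quantify over.      *)
Record module_structure (R : pzRingType) (V : zmodType) := ModuleStructure {
  act : R -> V -> V;
  actA : forall a b v, act a (act b v) = act (a * b) v;
  act1 : forall v, act 1 v = v;
  actDr : forall a u v, act a (u + v) = act a u + act a v;
  actDl : forall a b v, act (a + b) v = act a v + act b v
}.

Definition free_of_rank_one (R : pzRingType) (V : zmodType)
    (s : module_structure R V) : Prop :=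
  exists v0 : V, bijective (fun a : R => act s a v0).

(* Main.v *)
Require Import Defs.
From HB Require Import structures.
From mathcomp Require Import all_boot all_order all_algebra qpoly.
From mathcomp Require Import boolp ring zify.

Set Implicit Arguments.
Unset Strict Implicit.
Unset Printing Implicit Defensive.

Import GRing.Theory.
Local Open Scope ring_scope.

(** Write $O = k[[t]]$, let $M$ be the matrix of $\theta$, and let
    $d_1 \ge \dots \ge d_n$ be the degrees of the Eisenstein factors $f_i$.  The
    two hypotheses on $V$ bound the same quantities from opposite sides.  Because
    $\theta$ strictly lowers a flag of $V/tV$ of type $(m_i)$, the corank of
    $\theta^j$ modulo $t$ is at least the sum of the $j$ largest $m_i$, which is
    $\sum_i \min(j, d_i)$ ([filtration_expmx_rank], [largest_parts]).  On the other
    hand $\det\theta^j$ has valuation $jn$.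

    For $j = s := d_n$, the least degree, the corank is thus at least $sn$, the length
    of $V/\theta^s V$.  So $\theta^s V$ contains $tV$, and $W = t\theta^{-s}$ is an
    endomorphism of $V$ ([red_rank_div]).  Now $f_i = X^{d_i} + t c_i$, so
    $\theta^{-s} f_i(\theta) = \theta^{d_i - s} + W c_i(\theta)$ is one as well.
    Modulo $\theta$, which lies in the Jacobson radical since it is nilpotent modulo
    $t$, these are affine in $W$ with constant coefficients, and the condition on
    the constant terms of the $f_i$ says exactly that the one for $f_n$ is comaximal
    with every other ([slope_quo_comaximal]).  Their product being 0 by
    Cayley-Hamilton, there is an idempotent commuting with $\theta$ that separates
    $f_n$ from the other factors ([eisenstein_peel]).  The summand belonging to $f_n$
    has characteristic polynomial $f_n$ and is cyclic, as the determinant of $\theta$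
    on it has valuation 1 ([eisenstein_cyclic]).  On the complement the corank
    bounds persist for the remaining factors, and induction gives
    $V = \bigoplus_i O[\theta] v_i$ with $O[\theta] v_i \cong O[X]/(f_i)$
    ([eisenstein_decomp]).

    This decomposition is the isomorphism $(x_i)_i \mapsto \sum_i x_i(\theta) v_i$
    from the product of the $O[X]/(f_i)$ to $V$; both module structures are
    transported along it. *)

(** * Power series: reduction modulo t *)

Section FpsConst.
Variable R : comNzRingType.
Implicit Types a b : {fps R}.

Definition fps0 a : R := a 0%N.

Fact fps0_is_zmod_morphism : zmod_morphism fps0. Proof. by []. Qed.
HB.instance Definition _ :=
  GRing.isZmodMorphism.Build {fps R} R fps0 fps0_is_zmod_morphism.
Fact fps0_is_monoid_morphism : monoid_morphism fps0.
Proof. by split=> // a b; rewrite /fps0 /= big_ord1. Qed.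
HB.instance Definition _ :=
  GRing.isMonoidMorphism.Build {fps R} R fps0 fps0_is_monoid_morphism.

Fact fpsC_is_zmod_morphism : zmod_morphism (@fpsC R).
Proof. by move=> c d; apply/fpsP => n /=; rewrite mulrnBl. Qed.
HB.instance Definition _ :=
  GRing.isZmodMorphism.Build R {fps R} (@fpsC R) fpsC_is_zmod_morphism.
Fact fpsC_is_monoid_morphism : monoid_morphism (@fpsC R).
Proof.
split=> // c d; apply/fpsP => n /=.
rewrite big_ord_recl /= subn0 big1 => [|i _]; last by rewrite mulr0n mul0r.
by rewrite addr0 mulr1n mulrnAr.
Qed.
HB.instance Definition _ :=
  GRing.isMonoidMorphism.Build R {fps R} (@fpsC R) fpsC_is_monoid_morphism.

Lemma fpsCK : cancel (@fpsC R) fps0. Proof. by []. Qed.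

Definition fps_shift a : {fps R} := Fps (fun n => a n.+1).

Lemma fps_coefTM a n : (fpsT * a) n = if n is m.+1 then a m else 0.
Proof.
case: n => [|n]; first by rewrite /= big_ord1 mul0r.
rewrite /= !big_ord_recl /= mul0r mul1r add0r big1 ?addr0 ?subn1 // => i _.
by rewrite mul0r.
Qed.

Lemma fps_shiftK a : fps0 a = 0 -> fpsT * fps_shift a = a.
Proof. by move=> a0; apply/fpsP => -[|n]; rewrite fps_coefTM //= -a0. Qed.

Lemma fpsTI : injective (fun a => fpsT * a).
Proof.
move=> a b ab; apply/fpsP => n.
by have /fpsP/(_ n.+1) := ab; rewrite !fps_coefTM.
Qed.

Lemma fps0T : fps0 (fpsT : {fps R}) = 0. Proof. by []. Qed.

Lemma fps_dvdT1 a : fps_dvdT 1 a -> fps0 a = 0.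
Proof. by case=> b ->; rewrite expr1 rmorphM mul0r. Qed.

Lemma fps_has_val1 a : fps_has_val a 1 ->
  a = fpsT * fps_shift a /\ fps0 (fps_shift a) != 0.
Proof.
case=> /fps_dvdT1 a0 na; rewrite fps_shiftK //; split=> //.
apply/negP => /eqP /fps_shiftK ab; apply: na.
by exists (fps_shift (fps_shift a)); rewrite expr2 -mulrA ab fps_shiftK.
Qed.

End FpsConst.

(** * Power series over a field form a local integral domain *)

Section FpsField.
Variable k : fieldType.
Implicit Types a b : {fps k}.

(** The coefficients of the inverse series, in reverse order: [fps_inv_seq a n]
    is $b_n, \dots, b_0$, so that the recursion for $b_{n+1}$ can read all of them. *)
Fixpoint fps_inv_seq a n : seq k :=
  if n is m.+1 then
    let s := fps_inv_seq a m in
    (- (a 0%N)^-1 * \sum_(i < m.+1) a i.+1 * s`_i) :: s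
  else [:: (a 0%N)^-1].

Definition fps_invf a : {fps k} := Fps (fun n => (fps_inv_seq a n)`_0).

Lemma nth_fps_inv_seq a n i : (i <= n)%N ->
  (fps_inv_seq a n)`_i = fps_invf a (n - i)%N.
Proof.
elim: n i => [|n IH] [|i] //; rewrite ltnS => /IH ih.
by rewrite subSS -ih.
Qed.

Lemma fps_mulfV a : fps0 a != 0 -> a * fps_invf a = 1.
Proof.
move=> a0; apply/fpsP => -[|n]; first by rewrite /= big_ord1 /= mulfV.
rewrite [LHS]big_ord_recl subn0 [fps_invf a _]/= mulNr mulrN mulVKf //.
apply/eqP; rewrite addrC subr_eq add0r; apply/eqP/eq_bigr => i _.
by rewrite nth_fps_inv_seq // -ltnS.
Qed.

Definition fps_unit : {pred {fps k}} := fun a => fps0 a != 0.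
Definition fps_inv a := if fps_unit a then fps_invf a else a.

Fact fps_mulVr : {in fps_unit, left_inverse 1 fps_inv *%R}.
Proof. by move=> a ua; rewrite mulrC /fps_inv ifT ?fps_mulfV. Qed.
Fact fps_unitP a b : b * a = 1 -> fps_unit a.
Proof.
move=> ba; apply/negP => /eqP a0; have /(congr1 (@fps0 k))/esym/eqP := ba.
by rewrite rmorphM rmorph1 /= a0 mulr0 oner_eq0.
Qed.
Fact fps_invr_out : {in [predC fps_unit], fps_inv =1 id}.
Proof. by move=> a ua; rewrite /fps_inv ifN. Qed.

HB.instance Definition _ := GRing.ComNzRing_hasMulInverse.Build {fps k}
  fps_mulVr fps_unitP fps_invr_out.

Fact fps_mulf_eq0 a b : a * b = 0 -> (a == 0) || (b == 0).
Proof.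
have nz (c : {fps k}) : c <> 0 -> exists n, c n != 0.
  by move=> c0; apply: contrapT => h; apply: c0; apply/fpsP => n;
     apply/eqP/negPn/negP => cn; apply: h; exists n.
move=> ab; case: eqP => //= /nz/ex_minnP[i ai mi].
case: eqP => // /nz/ex_minnP[j bj mj].
have /fpsP/(_ (i + j)%N) := ab; have iij : (i < (i + j).+1)%N by rewrite ltnS leq_addr.
rewrite /= (bigD1 (Ordinal iij)) //= big1 => [|l]; last first.
  rewrite -val_eqE /= => li; have [{}li|il] := ltnP l i.
    have /eqP -> : a l == 0 by apply/negPn/negP => /mi; rewrite leqNgt li.
    by rewrite mul0r.
  have /eqP -> : b (i + j - l)%N == 0; last by rewrite mulr0.
  apply/negPn/negP => /mj; rewrite leqNgt; case/negP.
  have {}li : (i < l)%N by rewrite ltn_neqAle eq_sym li.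
  rewrite ltn_subLR; last by rewrite -ltnS.
  by rewrite ltn_add2r.
by rewrite addr0 addKn => /eqP; rewrite mulf_eq0 (negPf ai) (negPf bj).
Qed.
HB.instance Definition _ :=
  GRing.ComUnitRing_isIntegral.Build {fps k} fps_mulf_eq0.

Lemma fps_unitE a : (a \is a GRing.unit) = (fps0 a != 0).
Proof. by []. Qed.

Lemma fpsT_neq0 : (fpsT : {fps k}) != 0.
Proof. by apply/eqP => /fpsP/(_ 1%N)/eqP /=; rewrite oner_eq0. Qed.

Lemma unitmx_fps n (A : 'M[{fps k}]_n) :
  (A \in unitmx) = (map_mx (@fps0 k) A \in unitmx).
Proof. by rewrite !unitmxE fps_unitE det_map_mx unitfE. Qed.

End FpsField.

(** * Polynomials evaluated at square matrices *)

Lemma mulmx_expS (R : pzSemiRingType) n (M : 'M[R]_n) i : M ^+ i.+1 = M *m M ^+ i.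
Proof. exact: exprS. Qed.

Section MxEval.
Variable R : comNzRingType.

(** A plain sum rather than a Horner evaluation in the matrix ring: blocks of size
    0, where that ring is trivial, must be covered. *)
Definition mxev n (M : 'M[R]_n) (p : {poly R}) : 'M[R]_n :=
  \sum_(i < size p) p`_i *: M ^+ i.

Lemma mxevE n (M : 'M[R]_n.+1) : mxev M =1 horner_mx M.
Proof.
move=> p; rewrite /horner_mx /horner_morph horner_poly; apply: eq_bigr => i _.
by rewrite -scalemx1 -mulmxE -scalemxAl mul1mx.
Qed.

Lemma mx0_eq (A B : 'M[R]_0) : A = B.
Proof. by rewrite (flatmx0 A) (flatmx0 B). Qed.

Fact mxev_is_zmod_morphism n (M : 'M[R]_n) : zmod_morphism (mxev M).
Proof.
case: n M => [|n] M p q; first exact: mx0_eq.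
by rewrite !mxevE rmorphB.
Qed.
HB.instance Definition _ n (M : 'M[R]_n) := GRing.isZmodMorphism.Build
  {poly R} 'M[R]_n (mxev M) (mxev_is_zmod_morphism M).
Fact mxev_is_monoid_morphism n (M : 'M[R]_n) : monoid_morphism (mxev M).
Proof.
case: n M => [|n] M; first by split=> [|p q]; apply: mx0_eq.
by split=> [|p q]; rewrite !mxevE ?rmorph1 ?rmorphM.
Qed.
HB.instance Definition _ n (M : 'M[R]_n) := GRing.isMonoidMorphism.Build
  {poly R} 'M[R]_n (mxev M) (mxev_is_monoid_morphism M).

Lemma mxevX n (M : 'M[R]_n) : mxev M 'X = M.
Proof. by case: n M => [|n] M; [exact: mx0_eq|rewrite mxevE horner_mx_X]. Qed.

Lemma mxevC n (M : 'M[R]_n) c : mxev M c%:P = c%:M.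
Proof. by case: n M => [|n] M; [exact: mx0_eq|rewrite mxevE horner_mx_C]. Qed.

Lemma mxevZ n (M : 'M[R]_n) c p : mxev M (c *: p) = c *: mxev M p.
Proof. by rewrite -mul_polyC rmorphM /= mxevC [LHS]mul_scalar_mx. Qed.

Lemma mxev_char_poly n (M : 'M[R]_n) : mxev M (char_poly M) = 0.
Proof. by case: n M => [|n] M; [exact: mx0_eq|rewrite mxevE Cayley_Hamilton]. Qed.

Lemma mxev_conj m n (P : 'M[R]_(m, n)) (D : 'M[R]_m) (M : 'M[R]_n) p :
  P *m M = D *m P -> P *m mxev M p = mxev D p *m P.
Proof.
move=> PM; rewrite /mxev mulmx_sumr mulmx_suml; apply: eq_bigr => i _.
rewrite -scalemxAl -scalemxAr; congr (_ *: _).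
elim: (i : nat) => [|j IH]; first by rewrite !expr0 mulmx1 mul1mx.
by rewrite !mulmx_expS -[RHS]mulmxA -IH !mulmxA PM.
Qed.

Lemma expmx_block m n (A : 'M[R]_m) (B : 'M[R]_n) j :
  block_mx A 0 0 B ^+ j = block_mx (A ^+ j) 0 0 (B ^+ j).
Proof.
elim: j => [|j IH]; first by rewrite !expr0 -scalar_mx_block.
by rewrite !mulmx_expS IH mulmx_block !mulmx0 !mul0mx !addr0 add0r.
Qed.

Lemma mxev_block m n (A : 'M[R]_m) (B : 'M[R]_n) p :
  mxev (block_mx A 0 0 B) p = block_mx (mxev A p) 0 0 (mxev B p).
Proof.
rewrite /mxev; elim/big_rec3: _ => [|i X Y Z _ ->].
  by rewrite block_mx0.
by rewrite expmx_block scale_block_mx add_block_mx !scaler0 !addr0.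
Qed.

Lemma char_poly_mul_similar m n (P : 'M[R]_(m, n)) (Q : 'M[R]_(n, m)) M :
  m = n -> P *m Q = 1%:M -> char_poly (P *m M *m Q) = char_poly M.
Proof.
move=> mn; case: _ / mn Q M P => Q M P PQ; rewrite /char_poly /char_poly_mx.
have pPQ : map_mx polyC P *m map_mx polyC Q = 1%:M :> 'M[{poly R}]_m.
  by rewrite -map_mxM PQ map_mx1.
have -> : 'X%:M - map_mx polyC (P *m M *m Q) =
    map_mx polyC P *m ('X%:M - map_mx polyC M) *m map_mx polyC Q.
  rewrite mulmxBr mulmxBl !map_mxM; congr (_ - _).
  by rewrite scalar_mxC -mulmxA pPQ mulmx1.
by rewrite !det_mulmx mulrAC -det_mulmx pPQ det1 mul1r.
Qed.

(** Over $R[X]$ the matrix $g(X) - g(M)$ is a multiple of $X - M$, so its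
    determinant is a multiple of the characteristic polynomial; modulo $g$ that
    determinant is $\pm\det g(M)$.  Hence over a domain $\det g(M) \ne 0$ makes $g$
    coprime to the characteristic polynomial of $M$. *)
Lemma char_poly_bezout n (M : 'M[R]_n) (g : {poly R}) :
  exists u v, char_poly M * u + g * v = (\det (mxev M g))%:P.
Proof.
(* The quotient of g(X) - g(M) by X - M, built along the Horner scheme. *)
have [Q EQ] : exists Q, g%:M - map_mx polyC (mxev M g) = char_poly_mx M *m Q.
  elim/poly_ind: g => [|g c [Q EQ]].
    by exists 0; rewrite [mxev M 0]raddf0 map_mx0 raddf0 subr0 mulmx0.
  exists (g%:M + map_mx polyC M *m Q).
  have XM : char_poly_mx M *m map_mx polyC M = map_mx polyC M *m char_poly_mx M.
    by rewrite mulmxBr mulmxBl scalar_mxC.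
  have -> : mxev M (g * 'X + c%:P) = M *m mxev M g + c%:M.
    by rewrite mulrC rmorphD rmorphM /= mxevX mxevC.
  rewrite map_mxD map_mxM map_scalar_mx raddfD opprD addrACA subrr addr0.
  rewrite mulmxDr mulmxA XM -mulmxA -EQ mulmxBr mulmxBl.
  by rewrite addrA subrK -scalar_mxM mulrC.
have : \det (g%:M - map_mx polyC (mxev M g)) = (char_poly (mxev M g)) \Po g.
  rewrite /char_poly -det_map_mx; congr (\det _); apply/matrixP => i j.
  by rewrite !mxE rmorphB /= comp_polyC rmorphMn /= comp_polyX.
rewrite EQ det_mulmx -/(char_poly M); set B := mxev M g.
have [p ->] : exists p, char_poly B = p * 'X + ((char_poly B)`_0)%:P.
  elim/poly_ind: (char_poly B) => [|p c _].
    by exists 0; rewrite coef0 mul0r addr0.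
  by exists p; rewrite coefD coefMX coefC add0r.
rewrite rmorphD rmorphM /= comp_polyX comp_polyC char_poly_det => E.
(* The constant term of the characteristic polynomial carries this sign. *)
pose s : {poly R} := (-1) ^+ n; have ss : s * s = 1 by rewrite -expr2 sqrr_sign.
have Es : ((-1) ^+ n * \det B)%:P = s * (\det B)%:P.
  by rewrite rmorphM rmorphXn rmorphN1.
exists (s * \det Q), (- s * (p \Po g)); rewrite mulrCA E Es.
by transitivity (s * s * (\det B)%:P); [ring|rewrite ss mul1r].
Qed.

End MxEval.

(** * Ranks over a field *)

Lemma mxev_poly (R : comNzRingType) n (M : 'M[R]_n) d (c : nat -> R) :
  mxev M (\poly_(i < d) c i) = \sum_(i < d) c i *: M ^+ i.
Proof.
rewrite poly_def raddf_sum /=; apply: eq_bigr => i _.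
by rewrite mxevZ rmorphXn /= mxevX.
Qed.

Section RankField.
Variable k : fieldType.

Lemma expmx_rank_ge n (A : 'M[k]_n) j :
  (n <= \rank A + 1)%N -> (n <= \rank (A ^+ j) + j)%N.
Proof.
move=> nA; elim: j => [|j IH]; first by rewrite expr0 mxrank1 addn0.
rewrite mulmx_expS; have := mxrank_mul_min A (A ^+ j); lia.
Qed.

Lemma idmx_rank n (A : 'M[k]_n) :
  A *m A = A -> (\rank A + \rank (1%:M - A)%R = n)%N.
Proof.
move=> AA; apply/eqP; rewrite eqn_leq mulmx0_rank_max /=; last first.
  by rewrite mulmxBr mulmx1 AA subrr.
have {1}<- : \rank (1%:M : 'M[k]_n) = n by rewrite mxrank1.
have {1}-> : 1%:M = A + (1%:M - A) :> 'M[k]_n by rewrite addrC subrK.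
exact: mxrank_add.
Qed.

(** A row $v$ outside the image of $N$ spans, together with the image, the whole
    space; feeding this into itself, the $v N^i$ span modulo the image of every
    power of $N$, hence span, $N$ being nilpotent. *)
Lemma nilpotent_cyclic n (N : 'M[k]_n) : N ^+ n = 0 -> (n <= \rank N + 1)%N ->
  exists v : 'rV[k]_n, row_full (\matrix_(i < n) (v *m N ^+ i)).
Proof.
case: n N => [|n] N Nn rN; first by exists 0; rewrite /row_full flatmx0 mxrank0.
have [i iN] : exists i, ~~ (row i 1%:M <= N)%MS.
  apply/existsP; rewrite -negb_forall; apply/negP => /forallP/row_subP.
  rewrite sub1mx row_full_unit => Nu.
  have NXu j : N ^+ j \in unitmx.
    by elim: j => [|j IH]; rewrite ?unitmx1 // mulmx_expS unitmx_mul Nu.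
  by have := NXu n.+1; rewrite Nn unitmxE det0 unitr0.
exists (row i 1%:M); move: (row i 1%:M) iN => v vN.
set U := \matrix_(_ < _) _.
have full : (1%:M <= v + N)%MS.
  rewrite sub1mx /row_full eqn_leq rank_leq_col /=.
  have : (\rank N < \rank (v + N))%N; last by lia.
  by apply: rank_ltmx; rewrite ltmxE addsmxSr addsmx_sub submx_refl andbT.
suff UN j : (j <= n.+1)%N -> (1%:M <= U + N ^+ j)%MS.
  by have := UN _ (leqnn _); rewrite Nn addsmx0 sub1mx.
elim: j => [|j IH] jn; first by rewrite expr0 addsmxSr.
apply: submx_trans (IH (ltnW jn)) _; rewrite addsmx_sub addsmxSl /=.
have := submxMr (N ^+ j) full; rewrite mul1mx addsmxMr => /submx_trans; apply.
rewrite -mulmx_expS addsmxS //.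
have -> : v *m N ^+ j = row (Ordinal jn) U by rewrite rowK.
exact: row_sub.
Qed.

End RankField.

(** * Matrices over power series and their reductions *)

Section Reduction.
Variable k : fieldType.
Local Notation O := {fps k}.
Local Notation red := (map_mx (@fps0 k)).

Lemma red_exp n (M : 'M[O]_n) j : red (M ^+ j) = red M ^+ j.
Proof.
elim: j => [|j IH]; first by rewrite !expr0 map_mx1.
by rewrite !mulmx_expS map_mxM IH.
Qed.

Lemma redK m n (A : 'M[k]_(m, n)) : red (map_mx (@fpsC k) A) = A.
Proof. by apply/matrixP => i j; rewrite !mxE. Qed.

(** Nakayama for free modules.  The two sizes are only propositionally equal:
    adapted bases arise with $m = a + b$. *)
Lemma invertible_mod_t m n (P : 'M[O]_(m, n)) : m = n -> row_full (red P) ->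
  exists Q, P *m Q = 1%:M /\ Q *m P = 1%:M.
Proof.
move=> mn; case: _ / mn P => P; rewrite row_full_unit -unitmx_fps => uP.
by exists (invmx P); rewrite mulmxV ?mulVmx.
Qed.

Lemma mulmx_cancelr (R : pzRingType) m n p (P : 'M[R]_(m, n)) Q :
  P *m Q = 1%:M -> forall A B : 'M_(p, m), A *m P = B *m P -> A = B.
Proof.
move=> PQ A B /(congr1 (mulmx^~ Q)).
by rewrite -(mulmxA A) -(mulmxA B) PQ !mulmx1.
Qed.

Lemma intertwine_mul (R : pzRingType) m n (P : 'M[R]_(m, n)) A A' B B' :
  P *m A = A' *m P -> P *m B = B' *m P -> P *m (A *m B) = (A' *m B') *m P.
Proof. by move=> PA PB; rewrite mulmxA PA -mulmxA PB mulmxA. Qed.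

Definition Tdiag r d : 'M[O]_r :=
  diag_mx (\row_(i < r) if (i < r - d)%N then 1 else fpsT).

Lemma det_Tdiag r d : (d <= r)%N -> \det (Tdiag r d) = fpsT ^+ d.
Proof.
move=> dr; rewrite det_diag.
under eq_bigr do rewrite mxE.
rewrite -(big_mkord xpredT (fun i => if (i < r - d)%N then 1 else fpsT : O)).
rewrite (big_cat_nat _ (leq_subr d r)) //= big_nat big1 => [|i /andP[_ ->] //].
rewrite mul1r big_nat (eq_bigr (fun=> fpsT)) => [|i /andP[]]; last first.
  by rewrite leqNgt => /negPf->.
by rewrite -big_nat prodr_const_nat subKn.
Qed.

(** Constant row operations kill $d$ rows of the reduction; in the corresponding
    rows of the matrix itself $t$ can be factored out. *)
Lemma red_factor r d (M : 'M[O]_r) : (\rank (red M) + d <= r)%N ->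
  exists P N, P \in unitmx /\ P *m M = Tdiag r d *m N.
Proof.
move=> rM; set P := map_mx (@fpsC k) (invmx (col_ebase (red M))).
exists P, (\matrix_(i, j)
  if (i < r - d)%N then (P *m M) i j else fps_shift ((P *m M) i j)).
split; first by rewrite unitmx_fps redK unitmx_inv col_ebase_unit.
apply/matrixP => i j; rewrite mul_diag_mx !mxE; case: ltnP => ird.
  by rewrite mul1r.
rewrite fps_shiftK //.
have -> : fps0 (\sum_l P i l * M l j) = (red (P *m M)) i j by rewrite !mxE.
rewrite map_mxM redK -{2}(mulmx_ebase (red M)) !mulmxA mulVmx ?col_ebase_unit //.
rewrite mul1mx mxE big1 // => l _; rewrite mxE.
have -> : (i < \rank (red M))%N = false by lia.
by rewrite andbF mul0r.
Qed.

(** The extreme case of [red_factor]: when the determinant has valuation exactly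
    $d$, the cofactor is invertible, so the cokernel of $M$ is killed by $t$, and
    $t M^{-1}$ is integral. *)
Lemma red_rank_div r d (M : 'M[O]_r) (u : O) : (\rank (red M) + d <= r)%N ->
  \det M = fpsT ^+ d * u -> fps0 u != 0 ->
  exists W, M *m W = fpsT%:M /\ W *m M = fpsT%:M.
Proof.
move=> rM dM u0; have [P [N [uP PM]]] := red_factor rM.
have dr : (d <= r)%N by lia.
have uN : N \in unitmx.
  have /(congr1 determinant) := PM.
  have Td : (fpsT : O) ^+ d != 0 by rewrite expf_neq0 ?fpsT_neq0.
  rewrite !det_mulmx dM det_Tdiag // mulrCA => /(mulfI Td) dN.
  by rewrite unitmxE -dN unitrM -unitmxE uP fps_unitE.
pose D' : 'M[O]_r := diag_mx (\row_(i < r) if (i < r - d)%N then fpsT else 1).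
have DD : Tdiag r d *m D' = fpsT%:M.
  rewrite mulmx_diag; apply/matrixP => i j; rewrite !mxE; case: ifP => _.
    by rewrite mul1r.
  by rewrite mulr1.
have D'D : D' *m Tdiag r d = fpsT%:M.
  by rewrite diag_mxC.
have EM : M = invmx P *m Tdiag r d *m N by rewrite -mulmxA -PM mulKmx.
exists (invmx N *m D' *m P); split.
  rewrite {1}EM !mulmxA mulmxK // -[X in X *m P]mulmxA DD.
  by rewrite scalar_mxC mulmxKV.
rewrite -!mulmxA PM [D' *m _]mulmxA D'D mulmxA.
by rewrite scalar_mxC mulmxKV.
Qed.

Lemma red_rank_ge r (M : 'M[O]_r) (u : O) :
  \det M = fpsT * u -> fps0 u != 0 -> (r <= \rank (red M) + 1)%N.
Proof.
move=> dM u0; rewrite leqNgt; apply/negP => rM.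
have [|P [N [uP PM]]] := @red_factor r 2 M; first by lia.
have /(congr1 determinant) := PM.
rewrite !det_mulmx dM det_Tdiag; last by lia.
rewrite mulrCA expr2 -mulrA => /fpsTI /(congr1 (@fps0 k)).
rewrite !rmorphM /=. rewrite mul0r => /eqP; rewrite mulf_eq0 (negPf u0) orbF.
by move: uP; rewrite unitmxE fps_unitE => /negPf->.
Qed.

Lemma cyclic_vector n (M : 'M[O]_n) :
  red M ^+ n = 0 -> (n <= \rank (red M) + 1)%N ->
  exists v : 'rV[O]_n,
    (forall w, exists p, w = v *m mxev M p) /\
    (forall p : {poly O}, (size p <= n)%N -> v *m mxev M p = 0 -> p = 0).
Proof.
move=> Mn rM; have [v0 v0C] := nilpotent_cyclic Mn rM.
pose v := map_mx (@fpsC k) v0; pose C := \matrix_(i < n) (v *m M ^+ i).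
have uC : C \in unitmx.
  rewrite unitmx_fps -row_full_unit; congr row_full: v0C.
  apply/row_matrixP => i; rewrite -map_row !rowK map_mxM redK red_exp //.
have vC (c : nat -> O) :
    v *m mxev M (\poly_(i < n) c i) = (\row_(i < n) c i) *m C.
  rewrite mxev_poly [RHS]mulmx_sum_row mulmx_sumr; apply: eq_bigr => i _.
  by rewrite -scalemxAr rowK mxE.
exists v; split=> [w|p sp].
  pose c := w *m invmx C.
  exists (\poly_(i < n) (rVpoly c)`_i); rewrite vC -[LHS](mulmxKV uC).
  by congr (_ *m _); apply/rowP => i; rewrite [RHS]mxE coef_rVpoly_ord.
have {1}-> : p = \poly_(i < n) p`_i.
  apply/polyP => i; rewrite coef_poly; case: ltnP => // ni.
  by rewrite nth_default // (leq_trans sp).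
rewrite vC => /(congr1 (mulmx^~ (invmx C))); rewrite mulmxK // mul0mx => p0.
apply/polyP => i; rewrite coef0; have [ni|ni] := ltnP i n.
  by have /rowP/(_ (Ordinal ni)) := p0; rewrite !mxE.
by rewrite nth_default // (leq_trans sp).
Qed.

(** Projective modules over the local ring $k[[t]]$ are free: bases of the images
    of the idempotent and of its complement modulo $t$ lift to a basis adapted to
    the decomposition, and a matrix commuting with the idempotent is block diagonal
    in it. *)
Lemma idempotent_blocks r (M e : 'M[O]_r) :
  e *m e = e -> e *m M = M *m e ->
  exists a b (P : 'M[O]_(a + b, r)) Q (Mg : 'M_a) (Mh : 'M_b),
    [/\ (a + b)%N = r, P *m Q = 1%:M, Q *m P = 1%:M,
        P *m M = block_mx Mg 0 0 Mh *m P & P *m e = block_mx 1%:M 0 0 0 *m P].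
Proof.
move=> ee eM; set eb := red e.
have ebeb : eb *m eb = eb by rewrite -map_mxM ee.
pose Bg := map_mx (@fpsC k) (row_base eb) *m e.
pose Bh := map_mx (@fpsC k) (row_base (1%:M - eb)) *m (1%:M - e).
pose P := col_mx Bg Bh.
have ab := idmx_rank ebeb.
have rbK m (A : 'M[k]_(m, r)) (B : 'M[k]_r) :
    B *m B = B -> (A <= B)%MS -> A *m B = A.
  by move=> BB /submxP[X ->]; rewrite -mulmxA BB.
have [Q [PQ QP]] : exists Q, P *m Q = 1%:M /\ Q *m P = 1%:M.
  (* Modulo t the rows of P are bases of two complementary subspaces. *)
  have rBg : red Bg = row_base eb.
    by rewrite (map_mxM (@fps0 k)) redK rbK ?eq_row_base.
  have rBh : red Bh = row_base (1%:M - eb).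
    rewrite (map_mxM (@fps0 k)) redK (map_mxB (@fps0 k)) (map_mx1 (@fps0 k)).
    rewrite rbK ?eq_row_base //.
    by rewrite mulmxBl !mulmxBr !mulmx1 !mul1mx ebeb subrr subr0.
  apply: (invertible_mod_t ab); rewrite map_col_mx rBg rBh.
  rewrite -sub1mx -addsmxE (adds_eqmx (eq_row_base _) (eq_row_base _)).
  have {1}-> : 1%:M = eb + (1%:M - eb) by rewrite addrC subrK.
  exact: addmx_sub_adds.
pose E : 'M[O]_(\rank eb + \rank (1%:M - eb)%R) := block_mx 1%:M 0 0 0.
have Pe : P *m e = E *m P.
  rewrite mul_block_col !mul0mx mul1mx !addr0 mul_col_mx -!mulmxA ee.
  by rewrite mulmxBl mul1mx ee subrr mulmx0.
pose D := P *m M *m Q.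
have PM : P *m M = D *m P by rewrite /D -mulmxA QP mulmx1.
have DE : D *m E = E *m D.
  apply: (mulmx_cancelr PQ).
  by rewrite -(intertwine_mul PM Pe) -(intertwine_mul Pe PM) eM.
have := DE; rewrite -{1 2}(submxK D) !mulmx_block.
rewrite !mul0mx !mulmx0 !mul1mx !mulmx1 !addr0.
case/eq_block_mx => _ ur dl _.
have ED : D = block_mx (ulsubmx D) 0 0 (drsubmx D).
  by rewrite -[LHS]submxK -ur dl.
exists (\rank eb), (\rank (1%:M - eb)%R), P, Q, (ulsubmx D), (drsubmx D).
by rewrite -ED.
Qed.

(** The idempotent cuts $M$ into blocks whose characteristic polynomials have
    product $g h$.  The hypotheses on $a$ and $b$ say that $h(M)$ is injective on
    the first block and $g(M)$ on the second; by [char_poly_bezout] the first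
    characteristic polynomial is prime to $h$ and the second to $g$, so they divide
    $g$ and $h$ respectively, and degrees force equality. *)
Lemma char_poly_split r (M e a b : 'M[O]_r) (g h : {poly O}) p q :
  char_poly M = g * h -> g \is monic -> h \is monic -> \det M != 0 ->
  e *m e = e -> e *m M = M *m e ->
  a *m mxev M g *m (1%:M - e) = M ^+ p *m (1%:M - e) ->
  b *m mxev M h *m e = M ^+ q *m e ->
  exists na nb (P : 'M[O]_(na + nb, r)) Q (Mg : 'M_na) (Mh : 'M_nb),
    [/\ (na + nb)%N = r, P *m Q = 1%:M, Q *m P = 1%:M &
     [/\ P *m M = block_mx Mg 0 0 Mh *m P, char_poly Mg = g & char_poly Mh = h]].
Proof.
move=> cpM gm hm dM ee eM Ea Eb.
have [na [nb [P [Q [Mg [Mh [nab PQ QP PM Pe]]]]]]] := idempotent_blocks ee eM.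
exists na, nb, P, Q, Mg, Mh; split=> //.
have cp : char_poly Mg * char_poly Mh = g * h.
  rewrite -cpM -(char_poly_mul_similar M nab PQ) PM -mulmxA PQ mulmx1.
  by rewrite /char_poly char_block_diag_mx det_ublock.
have det0 n (A : 'M[O]_n) : ((char_poly A)`_0 == 0) = (\det A == 0).
  by rewrite char_poly_det mulf_eq0 expf_eq0 oppr_eq0 oner_eq0 andbF.
have [dMg dMh] : \det Mg != 0 /\ \det Mh != 0.
  apply/andP; rewrite -negb_or -!det0 -mulf_eq0 -coef0M cp -cpM.
  by rewrite det0.
have Pexp j : P *m M ^+ j = block_mx (Mg ^+ j) 0 0 (Mh ^+ j) *m P.
  by have := mxev_conj 'X^j PM; rewrite !rmorphXn /= !mxevX expmx_block.
have dg : \det (mxev Mh g) != 0.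
  have Pe' : P *m (1%:M - e) = block_mx 0 0 0 1%:M *m P.
    rewrite mulmxBr mulmx1 Pe -{1}[P]mul1mx -mulmxBl; congr (_ *m P).
    by rewrite scalar_mx_block opp_block_mx add_block_mx !oppr0 !addr0 subrr.
  have Pa : P *m a = (P *m a *m Q) *m P by rewrite -(mulmxA _ Q) QP mulmx1.
  have := congr1 (mulmx P) Ea.
  rewrite (intertwine_mul (intertwine_mul Pa (mxev_conj g PM)) Pe').
  rewrite (intertwine_mul (Pexp p) Pe') => /(mulmx_cancelr PQ).
  rewrite mxev_block -{1}(submxK (P *m a *m Q)) !mulmx_block.
  rewrite !mul0mx !mulmx0 !mulmx1 !add0r => /eq_block_mx[_ _ _].
  move=> /(congr1 determinant); rewrite det_mulmx => E.
  apply: contra_neq (_ : \det (Mh ^+ p) != 0) => [g0|].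
    by rewrite -E g0 mulr0.
  elim: (p) => [|j IH]; first by rewrite expr0 det1 oner_neq0.
  by rewrite mulmx_expS det_mulmx mulf_neq0.
have dh : \det (mxev Mg h) != 0.
  have Pa : P *m b = (P *m b *m Q) *m P by rewrite -(mulmxA _ Q) QP mulmx1.
  have := congr1 (mulmx P) Eb.
  rewrite (intertwine_mul (intertwine_mul Pa (mxev_conj h PM)) Pe).
  rewrite (intertwine_mul (Pexp q) Pe) => /(mulmx_cancelr PQ).
  rewrite mxev_block -{1}(submxK (P *m b *m Q)) !mulmx_block.
  rewrite !mul0mx !mulmx0 !mulmx1 !addr0 => /eq_block_mx[+ _ _ _].
  move=> /(congr1 determinant); rewrite det_mulmx => E.
  apply: contra_neq (_ : \det (Mg ^+ q) != 0) => [g0|].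
    by rewrite -E g0 mulr0.
  elim: (q) => [|j IH]; first by rewrite expr0 det1 oner_neq0.
  by rewrite mulmx_expS det_mulmx mulf_neq0.
have copr n (A : 'M[O]_n) f : \det (mxev A f) != 0 -> coprimep (char_poly A) f.
  move=> dA; apply/Bezout_coprimepP; have [u [v uv]] := char_poly_bezout A f.
  by exists (u, v); rewrite /= mulrC [v * _]mulrC uv -size_poly_eq1 size_polyC dA.
have dvg : char_poly Mg %| g.
  by rewrite -(Gauss_dvdpl _ (copr _ _ _ dh)) -cp dvdp_mulr.
have dvh : char_poly Mh %| h.
  by rewrite -(Gauss_dvdpr _ (copr _ _ _ dg)) -cp dvdp_mull.
have gn := monic_neq0 gm; have hn := monic_neq0 hm.
have sg := dvdp_leq gn dvg; have sh := dvdp_leq hn dvh.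
have cpn n (A : 'M[O]_n) : char_poly A != 0.
  by rewrite monic_neq0 ?char_poly_monic.
have E : (na.+1 + nb.+1 = size g + size h)%N.
  have gt0 : (0 < size g + size h)%N by rewrite addn_gt0 size_poly_gt0 gn.
  rewrite -[RHS]prednK // -size_mul // -cp size_mul ?cpn // !size_char_poly.
  by rewrite !addnS.
rewrite size_char_poly in sg; rewrite size_char_poly in sh.
have sgE : na.+1 = size g.
  by apply/eqP; rewrite eqn_leq sg -(leq_add2r (size h)) -E leq_add2l.
have shE : nb.+1 = size h by apply/eqP; rewrite -(eqn_add2l na.+1) E sgE.
have eqcp n (A : 'M[O]_n) f :
    f \is monic -> char_poly A %| f -> n.+1 = size f -> char_poly A = f.
  move=> fm dvf sf; apply/eqP; rewrite -eqp_monic ?char_poly_monic //.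
  by rewrite -dvdp_size_eqp // size_char_poly sf.
by split=> //; apply: eqcp.
Qed.

End Reduction.

(** * The bicommutant of a matrix *)

Section Bicommutant.
Variables (R : comNzRingType) (n : nat) (M : 'M[R]_n).

(** The matrices commuting with everything that commutes with $M$: a commutative
    ring containing $R[M]$ and closed under existing inverses, in which all
    the idempotents below are found. *)
Definition bicomm (X : 'M[R]_n) :=
  forall Y, Y *m M = M *m Y -> Y *m X = X *m Y.

Lemma bicommC X Y : bicomm X -> bicomm Y -> X *m Y = Y *m X.
Proof. by move=> bX bY; apply/bY/esym/bX. Qed.

Lemma bicommD X Y : bicomm X -> bicomm Y -> bicomm (X + Y).
Proof. by move=> bX bY Z ZM; rewrite mulmxDr mulmxDl bX // bY. Qed.

Lemma bicommZ c X : bicomm X -> bicomm (c *: X).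
Proof. by move=> bX Z ZM; rewrite -scalemxAr -scalemxAl bX. Qed.

Lemma bicommM X Y : bicomm X -> bicomm Y -> bicomm (X *m Y).
Proof. by move=> bX bY Z ZM; rewrite mulmxA bX // -mulmxA bY // mulmxA. Qed.

Lemma bicomm_mxev p : bicomm (mxev M p).
Proof. by move=> Z ZM; rewrite (mxev_conj _ ZM). Qed.

Lemma bicommX i : bicomm (M ^+ i).
Proof. by have := @bicomm_mxev 'X^i; rewrite rmorphXn /= mxevX. Qed.

Lemma bicomm_expmx X i : bicomm X -> X *m M ^+ i = M ^+ i *m X.
Proof. by move=> bX; apply: bicommC (bicommX i). Qed.

Lemma bicomm_scalar c : bicomm c%:M.
Proof. by move=> Z ZM; rewrite scalar_mxC. Qed.

(** A polynomial $h$ whose value at $M$ becomes comaximal with $G$ after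
    division by a power of $M$. *)
Definition comaximal_quo (G : 'M[R]_n) (h : {poly R}) := exists X q,
  [/\ bicomm X, mxev M h = M ^+ q *m X
    & exists a b, [/\ bicomm a, bicomm b & a *m G + b *m X = 1%:M]].

Lemma comaximal_quo1 G : comaximal_quo G 1.
Proof.
exists 1%:M, 0%N; split; first exact: bicomm_scalar.
  by rewrite rmorph1 mulmx1.
exists 0%:M, 1%:M; split; try exact: bicomm_scalar.
by rewrite raddf0 mul0mx mulmx1 add0r.
Qed.

Lemma comaximal_quoM G h h' :
  bicomm G -> comaximal_quo G h -> comaximal_quo G h' -> comaximal_quo G (h * h').
Proof.
move=> bG [X [q [bX hX [a [b [ba bb ab]]]]]].
move=> [X' [q' [bX' hX' [a' [b' [ba' bb' ab']]]]]].
exists (X *m X'), (q + q')%N; split; first exact: bicommM.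
  have -> : M ^+ (q + q') = M ^+ q *m M ^+ q' by exact: exprD.
  rewrite rmorphM /= hX hX' -[LHS]/(_ *m _) -!(mulmxA (M ^+ q)).
  by rewrite (mulmxA X) (bicomm_expmx _ bX) (mulmxA _ X).
exists (a + b *m X *m a'), (b *m b'); split.
- by apply: bicommD => //; apply: bicommM => //; apply: bicommM.
- exact: bicommM.
have -> : b *m b' *m (X *m X') = b *m X *m (b' *m X').
  by rewrite !mulmxA -(mulmxA b b') (bicommC bb' bX) mulmxA.
by rewrite mulmxDl -addrA -[_ *m a' *m G]mulmxA -mulmxDr ab' mulmx1.
Qed.

End Bicommutant.

Lemma bicomm_invmx (R : comUnitRingType) n (M X : 'M[R]_n) :
  X \in unitmx -> bicomm M X -> bicomm M (invmx X).
Proof.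
move=> uX bX Z ZM; rewrite -[LHS]mul1mx -(mulVmx uX) -mulmxA; congr (_ *m _).
by rewrite mulmxA -bX // mulmxK.
Qed.

Lemma scalar_add_nilpotent_unit (k : fieldType) n (N : 'M[k]_n) m c :
  N ^+ m = 0 -> c != 0 -> c%:M + N \in unitmx.
Proof.
move=> Nm c0; have cN : GRing.comm (c%:M : 'M[k]_n) (- N).
  by apply: commrN; rewrite /GRing.comm [LHS]mul_scalar_mx [RHS]mul_mx_scalar.
have := subrXX_comm m cN; rewrite exprNn Nm mulr0 subr0 opprK => E.
have cm : (c%:M : 'M[k]_n) ^+ m = (c ^+ m)%:M by rewrite rmorphXn.
rewrite cm in E; move: (\sum_(i < m) _) E => S E.
have : (c%:M + N) *m ((c ^+ m)^-1 *: S) = 1%:M.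
  rewrite -scalemxAr -[(_ + _) *m S]/(_ * S) -E scale_scalar_mx.
  by rewrite mulVf // expf_neq0.
by case/mulmx1_unit.
Qed.

(** * Dividing out the least slope *)

Section Slope.
(** Here $W$ is $t M^{-s}$, and [Mrad] says that $M$ lies in the Jacobson radical
    of its bicommutant. *)
Variables (R : comUnitRingType) (r s : nat) (t : R) (M W : 'M[R]_r).
Hypothesis t_reg : GRing.lreg t.
Hypothesis MW : M ^+ s *m W = t%:M.
Hypothesis WM : W *m M ^+ s = t%:M.
Hypothesis Mrad : forall y Y, y \is a GRing.unit -> bicomm M Y ->
  y%:M + M *m Y \in unitmx.

Lemma bicomm_divT : bicomm M W.
Proof.
move=> Y YM; have YMs := bicommX s YM.
have : W *m (M ^+ s *m Y) *m W = W *m (Y *m M ^+ s) *m W by rewrite YMs.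
rewrite !mulmxA WM -(mulmxA (W *m Y)) MW mul_mx_scalar -mulmxA mul_scalar_mx.
move=> /matrixP E; apply/matrixP => i j; apply: t_reg.
by have := E i j; rewrite ![(_ *: _ : 'M_r) i j]mxE.
Qed.

(** This is $M^{-s} f(M)$ for $f = X^d + t c$. *)
Definition slope_quo (d : nat) (c : {poly R}) : 'M[R]_r :=
  (M ^+ (d - s) : 'M[R]_r) + W *m mxev M c.

Lemma bicomm_slope_quo d c : bicomm M (slope_quo d c).
Proof.
exact: bicommD (bicommX _) (bicommM bicomm_divT (bicomm_mxev _)).
Qed.

Lemma slope_quoE d c : (s <= d)%N ->
  mxev M ('X^d + t *: c) = M ^+ s *m slope_quo d c.
Proof.
move=> sd; rewrite rmorphD rmorphXn /= mxevX mxevZ mulmxDr mulmxA MW.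
rewrite mul_scalar_mx; congr (_ + _).
by rewrite [RHS](_ : _ = M ^+ s * M ^+ (d - s)) // -exprD subnKC.
Qed.

(** Modulo $M$ the quotients of $X^s + t c_0$ and $X^d + t c$ are $1 + c_0(0) W$ and
    $\delta_{d,s} + c(0) W$.  The combination eliminating $W$ is $c(0)$ if $d > s$,
    and $c(0) - c_0(0)$ if $d = s$: a unit modulo the radical. *)
Lemma slope_quo_comaximal (c0 : {poly R}) d (c : {poly R}) : (s <= d)%N ->
    c`_0 \is a GRing.unit -> (d = s -> c`_0 - c0`_0 \is a GRing.unit) ->
  exists a b, [/\ bicomm M a, bicomm M b &
    a *m slope_quo s c0 + b *m slope_quo d c = 1%:M].
Proof.
move=> sd cn0 cc0.
have polyX (p : {poly R}) : exists q, mxev M p = (p`_0)%:M + M *m mxev M q.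
  elim/poly_ind: p => [|p e _].
    by exists 0; rewrite coef0 !raddf0 addr0.
  exists p; rewrite coefD coefMX coefC add0r addrC rmorphD /= mxevC.
  by rewrite mulrC rmorphM /= mxevX.
have [p Ep] := polyX c; have [p0 Ep0] := polyX c0.
have bW := bicomm_divT; have bM : bicomm M M by move=> Y.
set x := c`_0 in cn0 cc0 Ep *; set x0 := c0`_0 in cc0 Ep0 *.
pose U := x *: slope_quo s c0 - x0 *: slope_quo d c.
pose Y0 := W *m (x *: mxev M p0 - x0 *: mxev M p).
have bY0 : bicomm M Y0.
  by apply: bicommM => //; rewrite -!mxevZ -raddfB; apply: bicomm_mxev.
have EU : U = x%:M - x0 *: (M ^+ (d - s) : 'M[R]_r) + M *m Y0.
  have Wc y B : W *m (y%:M + M *m B) = y *: W + M *m (W *m B).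
    by rewrite mulmxDr mul_mx_scalar mulmxA (bicommC bW bM) -mulmxA.
  have EY : M *m Y0 =
      x *: (M *m (W *m mxev M p0)) - x0 *: (M *m (W *m mxev M p)).
    by rewrite /Y0 !mulmxBr -!scalemxAr.
  rewrite EY /U /slope_quo subnn Ep Ep0 !Wc -[x%:M]scalemx1.
  move: (M *m (W *m mxev M p)) (M *m (W *m mxev M p0)) => B B0.
  have -> : M ^+ 0 = 1%:M by [].
  move: (1%:M : 'M[R]_r) (M ^+ _ : 'M[R]_r) => I1 Me.
  by apply/matrixP => i j; rewrite !mxE; ring.
have [y [Y [y0 bY EUY]]] : exists y Y,
    [/\ y \is a GRing.unit, bicomm M Y & U = y%:M + M *m Y].
  have [ds|ds] := eqVneq d s.
    exists (x - x0), Y0; split=> //; first exact: cc0.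
    rewrite EU ds subnn raddfB /=; congr (_ - _ + _).
    by rewrite -scalemx1.
  exists x, (Y0 - x0 *: (M ^+ (d - s).-1 : 'M[R]_r)); split=> //.
    by rewrite -scaleNr; apply: bicommD => //; apply/bicommZ/bicommX.
  rewrite EU mulmxBr -scalemxAr -mulmx_expS prednK ?subn_gt0; last by lia.
  by rewrite -addrA [- _ + _]addrC.
have uU : U \in unitmx by rewrite EUY; apply: Mrad.
have bU : bicomm M U.
  rewrite EUY; apply: bicommD; first exact: bicomm_scalar.
  exact: bicommM.
exists (x *: invmx U), (- x0 *: invmx U); split.
- exact/bicommZ/bicomm_invmx.
- exact/bicommZ/bicomm_invmx.
by rewrite -!scalemxAl !scalemxAr scaleNr -mulmxDr mulVmx.
Qed.

End Slope.

(** * Products of Eisenstein polynomials as characteristic polynomials *)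

Section Eisenstein.
Variable k : fieldType.
Local Notation O := {fps k}.
Local Notation red := (map_mx (@fps0 k)).

Lemma det_neq0_mulI n (A X : 'M[O]_n) : \det A != 0 -> A *m X = 0 -> X = 0.
Proof.
move=> dA /(congr1 (mulmx (\adj A))); rewrite mulmxA mul_adj_mx mulmx0.
rewrite mul_scalar_mx => /matrixP E; apply/matrixP => i j; apply/eqP.
have /eqP := E i j; rewrite !mxE mulf_eq0.
by rewrite (negPf dA).
Qed.

Lemma eisenstein_size (f : {poly O}) : eisenstein f -> (1 < size f)%N.
Proof.
case=> fm _ /fps_has_val1[f0 _]; rewrite ltnNge; apply/negP => sf.
have f1 : size f = 1%N.
  by apply/eqP; rewrite eqn_leq sf size_poly_gt0 monic_neq0.
have : f`_0 = 1 by move: fm; rewrite monicE lead_coefE f1 => /eqP.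
rewrite f0 => /(congr1 (@fps0 k)); rewrite rmorphM rmorph1 /= mul0r => /eqP.
by rewrite eq_sym oner_eq0.
Qed.

Lemma eisensteinP (f : {poly O}) : eisenstein f ->
  exists c : {poly O}, [/\ f = 'X^((size f).-1) + fpsT *: c,
     f`_0 = fpsT * c`_0 & fps0 c`_0 != 0].
Proof.
move=> ef; have sf := eisenstein_size ef.
case: (ef) => fm fd /fps_has_val1[f0 f0n].
exists (\poly_(i < (size f).-1) fps_shift f`_i).
have -> : (\poly_(i < (size f).-1) fps_shift f`_i)`_0 = fps_shift f`_0.
  by rewrite coef_poly; case: (size f) sf => [|[]].
split=> //; apply/polyP => i; rewrite coefD coefXn coefZ coef_poly.
have [ilt|ige|->] := ltngtP i (size f).-1.
- by rewrite add0r fps_shiftK //; apply/fps_dvdT1/fd.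
- by rewrite mulr0 addr0 nth_default // -(ltn_predK sf).
- by rewrite mulr0 addr0; move: fm; rewrite monicE lead_coefE => /eqP.
Qed.

Section Factors.
Variables (r n : nat) (M : 'M[O]_r) (f_ : 'I_n -> {poly O}).
Hypothesis cpM : char_poly M = \prod_i f_ i.
Hypothesis ef : forall i, eisenstein (f_ i).

Lemma char_poly_prod_size : r = (\sum_i (size (f_ i)).-1)%N.
Proof.
have := size_char_poly M; rewrite cpM size_prod => [|i _]; last first.
  by rewrite monic_neq0 //; case: (ef i).
have -> : (\sum_i size (f_ i) = \sum_i (size (f_ i)).-1 + n)%N.
  rewrite -[X in (_ + X)%N]card_ord -sum1_card -big_split /=.
  by apply: eq_bigr => i _; rewrite addn1 (ltn_predK (eisenstein_size (ef i))).
by rewrite card_ord; lia.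
Qed.

Lemma red_nilpotent : red M ^+ r = 0.
Proof.
have cr : char_poly (red M) = 'X^r.
  rewrite -map_char_poly cpM rmorph_prod {1}char_poly_prod_size.
  rewrite -prodrXr; apply: eq_bigr => i _.
  have [c [fE _ _]] := eisensteinP (ef i).
  rewrite {1}fE rmorphD /= map_polyXn map_polyZ /=.
  by rewrite scale0r addr0.
by have := mxev_char_poly (red M); rewrite cr rmorphXn /= mxevX.
Qed.

Lemma det_eisenstein :
  exists u, \det M = fpsT ^+ n * u /\ fps0 u != 0.
Proof.
have f0 : exists u, (\prod_i f_ i)`_0 = fpsT ^+ n * u /\ fps0 u != 0.
  exists (\prod_i fps_shift (f_ i)`_0); split.
    rewrite (big_morph (fun p : {poly O} => p`_0) (@coef0M _) (coef1 _ 0)).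
    rewrite -[X in _ ^+ X]card_ord -prodr_const -big_split /=.
    apply: eq_bigr => i _.
    by case: (ef i) => _ _ /fps_has_val1[].
  rewrite rmorph_prod; apply/prodf_neq0 => i _.
  by case: (ef i) => _ _ /fps_has_val1[].
have [u [uE u0]] := f0; exists ((-1) ^+ r * u); split.
  by rewrite mulrCA -uE -cpM char_poly_det mulrA -expr2 sqrr_sign mul1r.
rewrite rmorphM rmorphXn rmorphN1 /= mulf_neq0 // expf_neq0 //.
by rewrite oppr_eq0 oner_eq0.
Qed.

Lemma det_eisenstein_neq0 : \det M != 0.
Proof.
have [u [-> u0]] := det_eisenstein; rewrite mulf_neq0 ?expf_neq0 ?fpsT_neq0 //.
by apply: contraNneq u0 => ->; rewrite rmorph0.
Qed.

End Factors.


(** Let $g$ be the factor of least degree $s$ and $h$ the product of the others.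
    The determinant of $M^s$ has valuation $s(n+1)$, which is also a lower bound for
    the corank of its reduction, so $W = t M^{-s}$ is integral.  By
    [slope_quo_comaximal] the values $M^{-s} g(M)$ and $M^{-q} h(M)$ are comaximal,
    say $a H_0 + b X = 1$, and their product vanishes by Cayley-Hamilton.  So $b X$
    is the idempotent separating $g$ from $h$. *)
Lemma eisenstein_peel r n (M : 'M[O]_r) (f_ : 'I_n.+1 -> {poly O}) :
  char_poly M = \prod_i f_ i -> (forall i, eisenstein (f_ i)) ->
  (forall i j : 'I_n.+1, (i <= j)%N -> (size (f_ j) <= size (f_ i))%N) ->
  (forall i j, i != j -> size (f_ i) = size (f_ j) ->
    fps_has_val ((f_ i)`_0 - (f_ j)`_0) 1%N) ->
  (forall j, (\rank (red M ^+ j) + \sum_i minn j (size (f_ i)).-1 <= r)%N) ->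
  exists na nb (P : 'M[O]_(na + nb, r)) Q (Mg : 'M_na) (Mh : 'M_nb),
    [/\ (na + nb)%N = r, P *m Q = 1%:M, Q *m P = 1%:M &
     [/\ P *m M = block_mx Mg 0 0 Mh *m P, char_poly Mg = f_ ord_max
       & char_poly Mh = \prod_(i < n) f_ (widen_ord (leqnSn n) i)]].
Proof.
move=> cpM ef df cf rk; set g := f_ ord_max; set s := (size g).-1.
have [u [dM u0]] := det_eisenstein cpM ef.
have dM0 := det_eisenstein_neq0 cpM ef.
have Mr := red_nilpotent cpM ef.
have sd i : (s <= (size (f_ i)).-1)%N.
  by have : (i <= @ord_max n)%N := leq_ord i; move/df; rewrite -/g; lia.
have dMs j : exists v, \det (M ^+ j) = fpsT ^+ (n.+1 * j) * v /\ fps0 v != 0.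
  exists (u ^+ j); rewrite rmorphXn expf_neq0 //; split=> //.
  elim: j => [|j IH]; first by rewrite muln0 mul1r det1.
  by rewrite mulmx_expS det_mulmx IH dM mulnS exprD (exprS u) mulrACA.
have [v [dMsv v0]] := dMs s.
(* Only the power M ^+ s enters the rank condition here, because s is the least
   degree and every minimum in the sum is s. *)
have rks : (\rank (red (M ^+ s)) + n.+1 * s <= r)%N.
  rewrite red_exp; apply: leq_trans (rk s); rewrite leq_add2l.
  rewrite (eq_bigr (fun=> s)) => [|i _]; last by apply/minn_idPl.
  by rewrite sum_nat_const card_ord.
have [W [MW WM]] := red_rank_div rks dMsv v0.
have Treg : GRing.lreg (fpsT : O) by apply/mulfI/fpsT_neq0.
have Mrad y Y : y \is a GRing.unit -> bicomm M Y -> y%:M + M *m Y \in unitmx.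
  move=> uy bY; rewrite unitmx_fps map_mxD map_scalar_mx map_mxM.
  apply: (@scalar_add_nilpotent_unit _ _ _ r) => //.
  have MY : GRing.comm (red M) (red Y).
    by rewrite /GRing.comm -[LHS](map_mxM (@fps0 k)) -[RHS](map_mxM (@fps0 k)) bY.
  by rewrite -[red M *m red Y]/(red M * red Y) exprMn_comm // Mr mul0r.
have bH := bicomm_slope_quo Treg MW WM.
have [c [gE g0 c0]] := eisensteinP (ef ord_max); rewrite -/g -/s in gE g0.
pose H0 := slope_quo s M W s c; have bH0 : bicomm M H0 by apply: bH.
have gG : mxev M g = M ^+ s *m H0 by rewrite {1}gE (slope_quoE MW).
pose h := \prod_(i < n) f_ (widen_ord (leqnSn n) i).
have cpM' : char_poly M = h * g by rewrite cpM big_ord_recr.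
have [X [q [bX hX [a [b [ba bb ab]]]]]] :
    comaximal_quo M H0 h.
  apply: big_ind; first exact: comaximal_quo1.
    by move=> h1 h2; apply: comaximal_quoM.
  move=> i _; set j := widen_ord _ i.
  have jn : j != ord_max by rewrite -val_eqE /= ltn_eqF.
  have [cj [fE f0 cj0]] := eisensteinP (ef j).
  exists (slope_quo s M W (size (f_ j)).-1 cj), s; split; first exact: bH.
    by rewrite {1}fE; apply: (slope_quoE MW).
  apply: (slope_quo_comaximal Treg MW WM) => // sj.
  have sE : size (f_ j) = size g.
    by have := eisenstein_size (ef j); have := eisenstein_size (ef ord_max);
       rewrite -/g; lia.
  have /fps_has_val1[] := cf _ _ jn sE.
  rewrite -/g f0 g0 -mulrBr => /fpsTI E.
  by rewrite fps_unitE -E.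
have hm i : f_ i \is monic by case: (ef i).
have XH0 : X *m H0 = 0.
  apply: (@det_neq0_mulI _ (M ^+ (q + s))).
    by have [w [-> w0]] := dMs (q + s)%N; rewrite mulf_neq0 ?expf_neq0 ?fpsT_neq0 //;
       apply: contraNneq w0 => ->; rewrite rmorph0.
  have := mxev_char_poly M; rewrite cpM' rmorphM /= hX gG => E.
  rewrite -[RHS]E; have -> : M ^+ (q + s) = M ^+ q *m M ^+ s by exact: exprD.
  rewrite -[RHS]/(_ *m _) -!(mulmxA (M ^+ q)).
  by rewrite (mulmxA X) (bicomm_expmx _ bX) (mulmxA _ X).
(* The complement of e is a *m H0, so X *m H0 = 0 makes e idempotent. *)
pose e := b *m X.
have ae : 1%:M - e = a *m H0 by rewrite -ab addrK.
have eae : e *m (1%:M - e) = 0.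
  rewrite ae /e -mulmxA (mulmxA X) (bicommC bX ba) -(mulmxA a) XH0.
  by rewrite !mulmx0.
have ee : e *m e = e.
  by apply/esym/eqP; rewrite -subr_eq0 -{1}[e]mulmx1 -mulmxBr eae.
have e'e' : (1%:M - e) *m (1%:M - e) = 1%:M - e.
  by rewrite mulmxBl mul1mx eae subr0.
have be : bicomm M e by apply: bicommM.
have Ea : a *m mxev M g *m (1%:M - e) = M ^+ s *m (1%:M - e).
  rewrite gG mulmxA (bicomm_expmx _ ba) -(mulmxA (M ^+ s)) -ae.
  by rewrite -(mulmxA (M ^+ s)) e'e'.
have Eb : b *m mxev M h *m e = M ^+ q *m e.
  rewrite hX mulmxA (bicomm_expmx _ bb) -(mulmxA (M ^+ q)) -/e.
  by rewrite -(mulmxA (M ^+ q)) ee.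
have eM : e *m M = M *m e by apply/esym/be.
have hmon : h \is monic by rewrite monic_prod // => i _; apply: hm.
have cpgh : char_poly M = g * h by rewrite cpM' mulrC.
exact: (char_poly_split cpgh (hm ord_max) hmon dM0 ee eM Ea Eb).
Qed.

End Eisenstein.

Section Decomposition.
Variable k : fieldType.
Local Notation O := {fps k}.
Local Notation red := (map_mx (@fps0 k)).

(** The determinant has valuation 1, so the reduction has corank at most 1; being
    nilpotent it has a cyclic vector, and so has the matrix. *)
Lemma eisenstein_cyclic n (M : 'M[O]_n) : eisenstein (char_poly M) ->
  (forall j, (n <= \rank (red M ^+ j) + j)%N) /\
  exists v : 'rV[O]_n,
    (forall w, exists p, w = v *m mxev M p) /\
    (forall p : {poly O}, (size p <= n)%N -> v *m mxev M p = 0 -> p = 0).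
Proof.
move=> eM.
have cpM : char_poly M = \prod_(i < 1) (fun=> char_poly M) i by rewrite big_ord1.
have [u [dM u0]] := det_eisenstein cpM (fun=> eM).
have Mn := red_nilpotent cpM (fun=> eM).
have rM : (n <= \rank (red M) + 1)%N by apply: red_rank_ge dM u0.
by split=> [j|]; [exact: expmx_rank_ge|exact: cyclic_vector].
Qed.

(** The decomposition, in the form $O^r = \bigoplus_i O[M] v_i$ with annihilators
    $(f_i)$.  Peeling off the last factor preserves the rank condition for the
    others, since a cyclic block of size $s$ contributes corank at most
    $\min(j, s)$ to the $j$-th power. *)
Lemma eisenstein_decomp n r (M : 'M[O]_r) (f_ : 'I_n -> {poly O}) :
  char_poly M = \prod_i f_ i -> (forall i, eisenstein (f_ i)) ->
  (forall i j : 'I_n, (i <= j)%N -> (size (f_ j) <= size (f_ i))%N) ->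
  (forall i j, i != j -> size (f_ i) = size (f_ j) ->
    fps_has_val ((f_ i)`_0 - (f_ j)`_0) 1%N) ->
  (forall j, (\rank (red M ^+ j) + \sum_i minn j (size (f_ i)).-1 <= r)%N) ->
  exists v : 'I_n -> 'rV[O]_r,
    [/\ forall i, v i *m mxev M (f_ i) = 0,
        forall w, exists p : 'I_n -> {poly O}, w = \sum_i v i *m mxev M (p i)
      & forall p : 'I_n -> {poly O}, (forall i, size (p i) < size (f_ i))%N ->
          \sum_i v i *m mxev M (p i) = 0 -> forall i, p i = 0].
Proof.
elim: n r M f_ => [|n IH] r M f_ cpM ef df cf rk.
  have r0 : r = 0%N by have := size_char_poly M; rewrite cpM big_ord0 size_poly1 => -[].
  exists (fun=> 0); split=> [[]|w|p _ _ []] //.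
  exists (fun=> 0); rewrite big_ord0.
  by apply/rowP => i; have := ltn_ord i; rewrite [X in (_ < X)%N]r0.
have [na [nb [P [Q [Mg [Mh [nab PQ QP [PM cg ch]]]]]]]] :=
  eisenstein_peel cpM ef df cf rk.
pose wd := @widen_ord n n.+1 (leqnSn n).
have wdE i : wd i = lift ord_max i by apply: ord_inj; rewrite lift_max.
have naE : size (f_ ord_max) = na.+1 by rewrite -cg size_char_poly.
have ecg : eisenstein (char_poly Mg) by rewrite cg.
have [rg [vg [vgen vfree]]] := eisenstein_cyclic ecg.
have Pexp j : P *m M ^+ j = block_mx (Mg ^+ j) 0 0 (Mh ^+ j) *m P.
  by have := mxev_conj 'X^j PM; rewrite !rmorphXn /= !mxevX expmx_block.
have rkh j : (\rank (red Mh ^+ j) +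
    \sum_(i < n) minn j (size (f_ (wd i))).-1 <= nb)%N.
  have rB : (\rank (red Mg ^+ j) + \rank (red Mh ^+ j) <= \rank (red M ^+ j))%N.
    rewrite -!red_exp -rank_diag_block_mx.
    have -> : block_mx (red (Mg ^+ j)) 0 0 (red (Mh ^+ j)) =
        red P *m red (M ^+ j) *m red Q.
      rewrite -(map_mxM (@fps0 k)) Pexp -(map_mxM (@fps0 k)).
      by rewrite -mulmxA PQ mulmx1 map_block_mx !map_mx0.
    by apply: leq_trans (mxrankM_maxl _ _) (mxrankM_maxr _ _).
  move: rB (rg j) (rk j); rewrite big_ord_recr naE /wd /=.
  move: (\rank _) (\rank _) (\rank _) (\sum_(i < n) _)%N => x y z S.
  by case: (leqP j na) => jn; lia.
have [vh [vh0 vhgen vhfree]] := IH nb Mh (f_ \o wd) ch (fun i => ef (wd i))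
  (fun i j ij => df (wd i) (wd j) ij) (fun i j ij => cf (wd i) (wd j) ij) rkh.
have row_blockE x y p : row_mx x y *m P *m mxev M p =
    row_mx (x *m mxev Mg p) (y *m mxev Mh p) *m P.
  rewrite -mulmxA (mxev_conj p PM) mulmxA mxev_block mul_row_block.
  by rewrite !mulmx0 addr0 add0r.
pose v (i : 'I_n.+1) := (if unlift ord_max i is Some j then row_mx 0 (vh j)
  else row_mx vg 0) *m P.
have vw i : v (wd i) = row_mx 0 (vh i) *m P.
  by rewrite wdE /v liftK.
have vm : v ord_max = row_mx vg 0 *m P by rewrite /v unlift_none.
have sumv (p : 'I_n.+1 -> {poly O}) : \sum_i v i *m mxev M (p i) =
    row_mx (vg *m mxev Mg (p ord_max)) (\sum_i vh i *m mxev Mh (p (wd i))) *m P.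
  rewrite big_ord_recr /= vm row_blockE mul0mx.
  have -> : \sum_(i < n) v (wd i) *m mxev M (p (wd i)) =
      row_mx 0 (\sum_i vh i *m mxev Mh (p (wd i))) *m P.
    rewrite (eq_bigr (fun i => row_mx 0 (vh i *m mxev Mh (p (wd i))) *m P)).
      rewrite -mulmx_suml; congr (_ *m _).
      elim/big_rec2: _ => [|i x y _ ->]; first by rewrite row_mx0.
      by rewrite add_row_mx addr0.
    by move=> i _; rewrite vw row_blockE mul0mx.
  by rewrite -mulmxDl add_row_mx add0r addr0.
exists v; split.
- move=> i; case: (unliftP ord_max i) => [j ->|->].
    by rewrite -wdE vw row_blockE mul0mx vh0 row_mx0 mul0mx.
  by rewrite vm row_blockE mul0mx -cg mxev_char_poly mulmx0 row_mx0 mul0mx.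
- move=> w; have [pg pgE] := vgen (lsubmx (w *m Q)).
  have [ph phE] := vhgen (rsubmx (w *m Q)).
  exists (fun i => if unlift ord_max i is Some j then ph j else pg).
  rewrite sumv unlift_none -pgE.
  rewrite (eq_bigr (fun i => vh i *m mxev Mh (ph i))) => [|i _].
    by rewrite -phE hsubmxK -mulmxA QP mulmx1.
  by rewrite wdE liftK.
move=> p sp; rewrite sumv => /(congr1 (mulmx^~ Q)).
rewrite -mulmxA PQ mulmx1 mul0mx -row_mx0 => /eq_row_mx[Eg Eh] i.
case: (unliftP ord_max i) => [j ->|->].
  by rewrite -wdE; apply: (vhfree (p \o wd)) => // l; apply: sp.
by apply: vfree => //; rewrite -ltnS -naE.
Qed.

End Decomposition.

(** * Strictly flag-lowering matrices and conjugate partitions *)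

Section FlagRank.
(** The rows of [B l] span the $l$-th step of a flag modulo the next one, and
    [A i] is the $i$-th step. *)
Variables (k : fieldType) (r sigma : nat) (m : 'I_sigma -> nat).
Variables (N : 'M[k]_r) (B : forall l, 'M[k]_(m l, r)).
Let A i := (\sum_(l < sigma | (i <= l)%N) <<B l>>)%MS.
Hypothesis A0 : row_full (A 0%N).
Hypothesis BN : forall l : 'I_sigma, (B l *m N <= A l.+1)%MS.

(** Going up the flag, applying $N$ once moves a step into the next one, at no cost
    in rank: spend the $\#S$ factors of the power at the steps in $S$.  At any other
    step the rank of the image grows by at most the dimension of the graded piece. *)
Lemma flag_expmx_rank (S : {set 'I_sigma}) :
  (\rank (N ^+ #|S|) <= \sum_(l | l \notin S) m l)%N.
Proof.
have Adec i j : (i <= j)%N -> (A j <= A i)%MS.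
  move=> ij; apply/sumsmx_subP => l jl.
  by apply: (sumsmx_sup l) => //; apply: leq_trans jl.
have AN i : (A i *m N <= A i.+1)%MS.
  rewrite sumsmxMr; apply/sumsmx_subP => l il.
  rewrite (eqmxMr _ (genmxE _)); apply: submx_trans (BN l) (Adec _ _ _).
  exact: il.
suff main d i (T : {set 'I_sigma}) : (i + d = sigma)%N ->
    (forall l : 'I_sigma, l \in T -> i <= l)%N ->
    (\rank (A i *m N ^+ #|T|) <= \sum_(l < sigma | (i <= l) && (l \notin T)) m l)%N.
  have := main sigma 0%N S (add0n _) (fun _ _ => isT).
  apply: leq_trans; rewrite -{1}[N ^+ _]mul1mx; apply: mxrankS.
  by apply: submxMr; rewrite sub1mx.
elim: d i T => [|d IH] i T.
  rewrite addn0 => -> _; rewrite [A _]big_pred0 ?mul0mx ?mxrank0 // => l.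
  by rewrite leqNgt ltn_ord.
rewrite addnS => id Ti; have isig : (i < sigma)%N by lia.
pose l0 := Ordinal isig.
have iE (l : 'I_sigma) : (i <= l)%N = (l == l0) || (i < l)%N.
  by rewrite -val_eqE /= leq_eqVlt eq_sym.
have [l0T|l0T] := boolP (l0 \in T).
  have -> : #|T| = #|T :\ l0|.+1 by rewrite (cardsD1 l0) l0T.
  rewrite mulmx_expS mulmxA; apply: leq_trans (mxrankS (submxMr _ (AN i))) _.
  apply: leq_trans (IH i.+1 (T :\ l0) _ _) _; first by rewrite addSn.
    move=> l /setD1P[ll0 /Ti]; rewrite leq_eqVlt => /orP[/eqP il|//].
    by case/eqP: ll0; apply/val_inj; rewrite /= -il.
  apply/eq_leq/eq_bigl => l; rewrite in_setD1 negb_and negbK iE.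
  by have [->|ll0] := eqVneq l l0; rewrite /= ?ltnn ?l0T.
have TS (l : 'I_sigma) : l \in T -> (i.+1 <= l)%N.
  move=> lT; have := Ti _ lT; rewrite leq_eqVlt => /orP[/eqP il|//].
  by case/negP: l0T; rewrite (_ : l0 = l) //; apply/val_inj; rewrite /= -il.
rewrite (bigD1 l0) /= ?leqnn //.
have -> : A i = (<<B l0>> + A i.+1)%MS.
  rewrite /A (bigD1 l0) /= ?leqnn //; congr (_ + _)%MS; apply: eq_bigl => l.
  by rewrite iE; have [->|ll0] := eqVneq l l0; rewrite /= ?ltnn ?andbT.
have /eqmxP/eqmx_rank -> := addsmxMr <<B l0>>%MS (A i.+1) (N ^+ #|T|).
apply: leq_trans (mxrank_adds_leqif _ _) _; apply: leq_add.
  apply: leq_trans (mxrankM_maxl _ _) _.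
  by rewrite mxrank_gen; apply: rank_leq_row.
apply: leq_trans (IH i.+1 T _ TS) _; first by rewrite addSn.
apply/eq_leq/eq_bigl => l; rewrite iE.
by have [->|ll0] := eqVneq l l0; rewrite /= ?ltnn ?andbF ?andbT.
Qed.

End FlagRank.

Section ConjugatePartition.
Variables (sigma : nat) (m : sigma.-tuple nat).

Lemma largest_partP l : (tnth m l <= largest_part m)%N.
Proof.
have : tnth m l \in partition_of m by rewrite mem_sort mem_tnth.
have : sorted geq (partition_of m) by apply: sort_sorted => x y; exact: leq_total.
rewrite /largest_part; case: (partition_of m) => // x s /= xs.
rewrite inE => /orP[/eqP-> //|ls].
have /allP := order_path_min (fun a b c ab bc => leq_trans bc ab) xs.
exact.
Qed.

Lemma conj_partE i : conj_part m i = #|[set l | i <= tnth m l]%N|.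
Proof.
rewrite /conj_part /partition_of (permP (permEl (perm_sort _ _))).
rewrite -sum1_count big_tuple -sum1_card.
by apply: eq_bigl => l; rewrite inE.
Qed.

(** Counting the cells of the rows in $S$ of the Young diagram column by column. *)
Lemma conj_part_sum (S : {set 'I_sigma}) :
  (\sum_(i < largest_part m) #|[set l in S | i < tnth m l]| =
   \sum_(l in S) tnth m l)%N.
Proof.
rewrite (eq_bigr (fun i : 'I_ _ => \sum_(l in S) (i < tnth m l)))%N => [|i _].
  have sumlt n x : (\sum_(i < n) (i < x) = minn n x)%N.
    elim: n => [|n IH]; first by rewrite big_ord0 min0n.
    by rewrite big_ord_recr IH /=; case: (ltnP n x); lia.
  rewrite exchange_big /=; apply: eq_bigr => l _.
  by rewrite sumlt; apply/minn_idPr/largest_partP.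
rewrite -sum1_card big_mkcond [RHS]big_mkcond /=; apply: eq_bigr => l _.
by rewrite inE; case: (l \in S).
Qed.

(** Take for $S$ the $j$ largest parts, chosen greedily, or all parts if there are
    fewer. *)
Lemma largest_parts j : exists S : {set 'I_sigma}, (#|S| <= j)%N /\
  forall i, (minn j #|[set l | i < tnth m l]| <=
             #|[set l in S | i < tnth m l]|)%N.
Proof.
elim: j => [|j [S [Sj HS]]]; first by exists set0; rewrite cards0; split=> // i; rewrite min0n.
have [ST|/forallPn[x0 x0S]] := boolP [forall x, x \in S].
  exists S; split=> [|i]; first exact: leqW.
  rewrite geq_min subset_leq_card ?orbT //.
  by apply/subsetP => l; rewrite !inE (forallP ST).
pose x := [arg max_(x > x0 | x \notin S) tnth m x].
have [xS xmax] : x \notin S /\ forall y, y \notin S -> (tnth m y <= tnth m x)%N.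
  by rewrite /x; case: arg_maxnP.
exists (x |: S); split=> [|i]; first by rewrite cardsU1 xS.
have [ix|xi] := ltnP i (tnth m x).
  have -> : [set l in x |: S | (i < tnth m l)%N] =
      x |: [set l in S | (i < tnth m l)%N].
    by apply/setP => l; rewrite !inE; case: eqP => // ->; rewrite ix.
  rewrite cardsU1 inE (negPf xS) add1n; apply: leq_trans (HS i : (_.+1 <= _.+1)%N).
  by rewrite -minnSS leq_min geq_minl (leq_trans (geq_minr _ _)).
rewrite geq_min subset_leq_card ?orbT //; apply/subsetP => l; rewrite !inE => il.
rewrite il andbT; apply/orP; right; apply/negPn/negP => /xmax/(leq_trans il).
by rewrite ltnNge xi.
Qed.

End ConjugatePartition.

(** * The parabolic filtration in coordinates *)

Section Coordinates.
Variables (R : comNzRingType) (V : lmodType R) (r : nat) (e : 'I_r -> V).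

Definition lincomb (c : 'rV[R]_r) : V := \sum_i c 0 i *: e i.

Lemma lincombD c d : lincomb (c + d) = lincomb c + lincomb d.
Proof. by rewrite -big_split /=; apply: eq_bigr => i _; rewrite mxE scalerDl. Qed.

Lemma lincombZ a c : lincomb (a *: c) = a *: lincomb c.
Proof. by rewrite scaler_sumr; apply: eq_bigr => i _; rewrite mxE scalerA. Qed.

Lemma is_basis_coord : is_basis e ->
  exists kap : V -> 'rV[R]_r, cancel kap lincomb /\ cancel lincomb kap.
Proof.
move=> be; have /choice[kap kapE] : forall v, exists c, v = lincomb c.
  by move=> v; have [c [vc _]] := be v; exists c.
exists kap; split=> [v|c]; first by rewrite -kapE.
by have [d [_ ud]] := be (lincomb c); rewrite -(ud _ (kapE _)) (ud c).
Qed.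

Lemma lincomb_endo (theta : {linear V -> V}) (M : 'M[R]_r) c :
  (forall j, theta (e j) = \sum_i M i j *: e i) ->
  theta (lincomb c) = lincomb (c *m M^T).
Proof.
move=> thM; rewrite /lincomb linear_sum.
under eq_bigr => j _ do rewrite linearZ /= thM scaler_sumr.
rewrite exchange_big /=; apply: eq_bigr => i _.
by rewrite mxE scaler_suml; apply: eq_bigr => j _; rewrite scalerA mxE.
Qed.

End Coordinates.

Lemma char_poly_tr (R : comNzRingType) n (M : 'M[R]_n) :
  char_poly M^T = char_poly M.
Proof.
rewrite /char_poly -det_tr; congr (\det _); apply/matrixP => i j.
by rewrite !mxE eq_sym.
Qed.

Section FiltrationRank.
Variables (k : fieldType) (V : lmodType {fps k}) (r sigma : nat).
Variables (m : sigma.-tuple nat) (F : nat -> {pred V}) (theta : {linear V -> V}).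
Variables (e : 'I_r -> V) (kap : V -> 'rV[{fps k}]_r) (N : 'M[{fps k}]_r).
Local Notation phi := (lincomb e).
Local Notation red := (map_mx (@fps0 k)).
Hypothesis kapK : cancel kap phi.
Hypothesis phiK : cancel phi kap.
Hypothesis phiN : forall c, theta (phi c) = phi (c *m N).

Lemma coordD u v : kap (u + v) = kap u + kap v.
Proof. by rewrite -{1}[u]kapK -{1}[v]kapK -lincombD phiK. Qed.

Lemma coordZ a u : kap (a *: u) = a *: kap u.
Proof. by rewrite -{1}[u]kapK -lincombZ phiK. Qed.

Definition residue v : 'rV[k]_r := red (kap v).

Lemma residueD u v : residue (u + v) = residue u + residue v.
Proof. by rewrite /residue coordD map_mxD. Qed.

Lemma residueZ a u : residue (a *: u) = fps0 a *: residue u.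
Proof. by rewrite /residue coordZ map_mxZ. Qed.

Lemma residue_theta u : residue (theta u) = residue u *m red N.
Proof. by rewrite /residue -{1}[u]kapK phiN phiK map_mxM. Qed.

Lemma residue_sum (I : Type) (s : seq I) (x : I -> V) :
  residue (\sum_(i <- s) x i) = \sum_(i <- s) residue (x i).
Proof.
apply: (big_morph _ residueD); rewrite -(scale0r (0 : V)) residueZ.
by rewrite rmorph0 scale0r.
Qed.

Hypothesis Hfilt : parabolic_filtration m F.
Hypothesis Hfield : forall i, (i < sigma)%N ->
  forall v, v \in F i -> theta v \in F i.+1.

(** The residues of the filtration form a flag of $V/tV$, which $\theta$ lowers
    strictly. *)
Lemma filtration_expmx_rank (S : {set 'I_sigma}) :
  (\rank (red N ^+ #|S|) <= \sum_(l | l \notin S) tnth m l)%N.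
Proof.
pose b l := sval (cid (filt_dim Hfilt l)).
have bP l : (forall i, b l i \in F l) /\ forall u, u \in F l ->
    exists! c : 'rV[k]_(tnth m l), u - \sum_i fpsC (c 0 i) *: b l i \in F l.+1.
  exact: svalP (cid (filt_dim Hfilt l)).
pose B l : 'M[k]_(tnth m l, r) := \matrix_i residue (b l i).
pose A i := (\sum_(l < sigma | (i <= l)%N) <<B l>>)%MS.
have FA d i v : (i + d = sigma)%N -> v \in F i -> (residue v <= A i)%MS.
  elim: d i v => [|d IH] i v.
    rewrite addn0 => -> /(filt_last Hfilt)[w ->].
    by rewrite residueZ fps0T scale0r sub0mx.
  rewrite addnS => id vi; have isig : (i < sigma)%N by lia.
  have [_ bS] := bP (Ordinal isig); have [c [cv _]] := bS v vi.
  set s := \sum_i _ in cv.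
  rewrite -[v](subrK s) addrC residueD; apply: addmx_sub.
    rewrite /s residue_sum; apply: summx_sub => j _.
    rewrite residueZ fpsCK; apply: scalemx_sub.
    apply: (sumsmx_sup (Ordinal isig)) => //; rewrite genmxE.
    by have := row_sub j (B (Ordinal isig)); rewrite rowK.
  apply: submx_trans (IH i.+1 _ _ cv) _; first by rewrite addSn.
  apply/sumsmx_subP => l il; apply: (sumsmx_sup l) => //.
  exact: ltnW.
apply: (@flag_expmx_rank _ _ _ _ _ B).
  rewrite -sub1mx; apply/row_subP => i; rewrite rowE mulmx1.
  have -> : delta_mx 0 i = residue (e i).
    have -> : e i = phi (delta_mx 0 i).
      rewrite /lincomb (bigD1 i) //= mxE !eqxx scale1r big1 ?addr0 // => j ji.
      by rewrite mxE (negPf ji) scale0r.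
    by rewrite /residue phiK map_delta_mx.
  by apply: (FA sigma) => //; rewrite (filt_first Hfilt).
move=> l; apply/row_subP => i; rewrite row_mul rowK -residue_theta.
apply: (FA (sigma - l.+1)%N); first by rewrite subnKC.
by apply: Hfield => //; case: (bP l).
Qed.

End FiltrationRank.

(** * Modules over a product of quotient rings *)

Lemma in_qpolyK (R : comNzRingType) (f : {poly R}) (a : {poly %/ f}) :
  in_qpoly f (a : {poly R}) = a.
Proof. by apply/val_inj; apply: in_qpoly_small; apply: size_mk_monic. Qed.

(** The image of a polynomial in the product, without passing through
    $R[X]/(f)$. *)
Definition qpoly_diag (R : comNzRingType) n (f_ : 'I_n -> {poly R})
    (p : {poly R}) : prod_qpoly f_ := fun i => in_qpoly (f_ i) p.

Section ProductAction.
Variables (R : comNzRingType) (n r : nat) (N : 'M[R]_r).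
Variables (f_ : 'I_n -> {poly R}) (v : 'I_n -> 'rV[R]_r).
Hypothesis f_mon : forall i, f_ i \is monic /\ (1 < size (f_ i))%N.
Hypothesis v0 : forall i, v i *m mxev N (f_ i) = 0.

(** The map $(x_i)_i \mapsto \sum_i v_i x_i(N)$, which is the inverse of the
    isomorphism of the module with the product. *)
Definition qpoly_eval (x : prod_qpoly f_) : 'rV[R]_r :=
  \sum_i v i *m mxev N (x i : {poly R}).

Lemma mk_monicE i : mk_monic (f_ i) = f_ i.
Proof. by case: (f_mon i) => fm fs; rewrite /mk_monic fm fs. Qed.

Lemma mxev_in_qpoly i p :
  v i *m mxev N (in_qpoly (f_ i) p : {poly R}) = v i *m mxev N p.
Proof.
case: (f_mon i) => fm fs.
rewrite /= mk_monicE {2}(Pdiv.RingMonic.rdivp_eq fm p) rmorphD /= mulmxDr.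
rewrite mulrC rmorphM /= -[mxev N (f_ i) * _]/(_ *m _) mulmxA v0 mul0mx add0r.
by [].
Qed.

Lemma qpoly_evalD x y : qpoly_eval (x + y) = qpoly_eval x + qpoly_eval y.
Proof.
rewrite -big_split /=; apply: eq_bigr => i _.
by rewrite -mulmxDr -rmorphD.
Qed.

(** [qpoly_eval] is linear over $R[X]$, acting on rows through $N$. *)
Lemma qpoly_evalM (p : {poly R}) x :
  qpoly_eval (qpoly_diag f_ p * x) = qpoly_eval x *m mxev N p.
Proof.
rewrite mulmx_suml; apply: eq_bigr => i _.
have -> : (qpoly_diag f_ p * x) i =
    in_qpoly (f_ i) (p * (x i : {poly R})).
  by rewrite in_qpolyM in_qpolyK.
rewrite mxev_in_qpoly mulrC rmorphM /= -mulmxA.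
by [].
Qed.

Lemma qpoly_eval_inj :
  (forall p : 'I_n -> {poly R}, (forall i, size (p i) < size (f_ i))%N ->
     \sum_i v i *m mxev N (p i) = 0 -> forall i, p i = 0) ->
  injective qpoly_eval.
Proof.
move=> vfree x y xy; apply/functional_extensionality_dep => i.
apply/eqP; rewrite -subr_eq0; apply/eqP/val_inj.
apply: (vfree (fun i => (x i : {poly R}) - (y i : {poly R}))) => [j|].
  rewrite -[X in (_ < X)%N](congr1 (fun q : {poly R} => size q) (mk_monicE j)).
  exact: size_mk_monic (x j - y j).
under eq_bigr do rewrite rmorphB mulmxBr.
by apply/eqP; rewrite sumrB subr_eq0; apply/eqP/xy.
Qed.

Lemma qpoly_eval_surj w :
  (exists p : 'I_n -> {poly R}, w = \sum_i v i *m mxev N (p i)) ->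
  exists x, w = qpoly_eval x.
Proof.
case=> p ->; exists (fun i => in_qpoly (f_ i) (p i)).
by apply: eq_bigr => i _; rewrite mxev_in_qpoly.
Qed.

End ProductAction.

Section ToProd.
Variables (R : comNzRingType) (f : {poly R}) (n : nat) (f_ : 'I_n -> {poly R}).
Hypothesis f_mon : forall i, f_ i \is monic /\ (1 < size (f_ i))%N.
Hypothesis fE : f = \prod_(i < n) f_ i.
Implicit Types a b : {poly %/ f}.

Lemma to_prod_in_qpoly p : to_prod_qpoly f_ (in_qpoly f p) = qpoly_diag f_ p.
Proof. exact: to_prod_qpolyE. Qed.

Lemma to_prod_qpolyM a b :
  to_prod_qpoly f_ (a * b) = to_prod_qpoly f_ a * to_prod_qpoly f_ b.
Proof.
rewrite -(in_qpolyK a) -(in_qpolyK b) -rmorphM !to_prod_in_qpoly.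
by apply/functional_extensionality_dep => i; apply: in_qpolyM.
Qed.

Lemma to_prod_qpolyD a b :
  to_prod_qpoly f_ (a + b) = to_prod_qpoly f_ a + to_prod_qpoly f_ b.
Proof.
rewrite -(in_qpolyK a) -(in_qpolyK b) -rmorphD !to_prod_in_qpoly.
by apply/functional_extensionality_dep => i; apply: in_qpolyD.
Qed.

Lemma to_prod_qpoly1 : to_prod_qpoly f_ (1 : {poly %/ f}) = 1.
Proof.
rewrite -(in_qpoly1 f) to_prod_in_qpoly.
by apply/functional_extensionality_dep => i; apply: in_qpoly1.
Qed.

Lemma to_prod_qpolyC c :
  to_prod_qpoly f_ (qpolyC f c) = qpoly_diag f_ c%:P.
Proof. by rewrite -(in_qpolyK (qpolyC f c)) to_prod_in_qpoly. Qed.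

End ToProd.

(** * The principal module structure *)

Theorem theorem4p3 (k : closedFieldType) (V : lmodType {fps k}) (r sigma : nat)
    (m : sigma.-tuple nat) (F : nat -> {pred V}) (theta : {linear V -> V})
    (f : {poly {fps k}}) (f_ : 'I_(largest_part m) -> {poly {fps k}}) :
  strongly_parabolic_Higgs r m F theta ->
  distinguished r theta f f_ ->
  exists sA : module_structure {poly %/ f} V,
    [/\ forall (c : {fps k}) (v : V), act sA (qpolyC f c) v = c *: v,
        forall v : V, act sA 'qX v = theta v
      & exists sT : module_structure (prod_qpoly f_) V,
          (forall (a : {poly %/ f}) (v : V),
             act sT (to_prod_qpoly f_ a) v = act sA a v)
          /\ free_of_rank_one sT].
Proof.
move=> [_ Hfilt Hfield] [[e [be [M [thM fM]]]] fprod feis fsize fcoef].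
have [kap [kapK phiK]] := is_basis_coord be.
(* Coordinates are rows, while M acts on columns. *)
pose phi := lincomb e; pose N := M^T.
have phiN c : theta (phi c) = phi (c *m N) by apply: lincomb_endo.
have cpN : char_poly N = \prod_i f_ i by rewrite char_poly_tr -fM fprod.
have f_mon i : f_ i \is monic /\ (1 < size (f_ i))%N.
  by split; [case: (feis i) | apply: eisenstein_size].
have fdec (i j : 'I_(largest_part m)) :
    (i <= j)%N -> (size (f_ j) <= size (f_ i))%N.
  move=> ij; rewrite !fsize ltnS; apply: sub_count => x /=.
  exact: leq_trans.
(* With S a set of j largest parts, the corank of the j-th power is at least the
   sum of the parts in S; by conjugation this is at least the sum of the minima. *)
have frk j : (\rank (map_mx (@fps0 k) N ^+ j) +
    \sum_i minn j (size (f_ i)).-1 <= r)%N.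
  have szE i : (size (f_ i)).-1 = #|[set l | i < tnth m l]%N|.
    by rewrite fsize conj_partE.
  have [S [Sj HS]] := largest_parts m j.
  have rE : r = (\sum_(l | l \notin S) tnth m l + \sum_(l in S) tnth m l)%N.
    rewrite (char_poly_prod_size cpN feis) addnC.
    transitivity (\sum_(l in [set: 'I_sigma]) tnth m l)%N.
      rewrite -conj_part_sum; apply: eq_bigr => i _; rewrite szE.
      by apply: eq_card => l; rewrite !inE.
    by rewrite (bigID (mem S)) /=; congr (_ + _)%N; apply: eq_bigl => l;
      rewrite !inE.
  rewrite [X in (_ <= X)%N]rE; apply: leq_add; last first.
    rewrite -conj_part_sum; apply: leq_sum => i _; rewrite szE; exact: HS.
  apply: leq_trans (filtration_expmx_rank kapK phiK phiN Hfilt Hfield S).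
  have -> : map_mx (@fps0 k) N ^+ j =
      map_mx (@fps0 k) N ^+ (j - #|S|) *m map_mx (@fps0 k) N ^+ #|S|.
    by rewrite -[RHS]/(_ * _) -exprD subnK.
  exact: mxrankM_maxr.
have [v [v0 vgen vfree]] := eisenstein_decomp cpN feis fdec fcoef frk.
pose Psi (x : prod_qpoly f_) := phi (qpoly_eval N v x).
have PsiD x y : Psi (x + y) = Psi x + Psi y.
  by rewrite /Psi qpoly_evalD /phi lincombD.
have PsiM p x : Psi (qpoly_diag f_ p * x) =
    phi (qpoly_eval N v x *m mxev N p).
  by rewrite /Psi qpoly_evalM.
have Psi_inj : injective Psi.
  by move=> x y /(can_inj phiK); apply: qpoly_eval_inj.
have /choice[psi psiK] : forall u, exists x, Psi x = u.
  move=> u; have [x xE] := qpoly_eval_surj f_mon v0 (vgen (kap u)).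
  by exists x; rewrite /Psi -xE /phi kapK.
have PsiK x : psi (Psi x) = x by apply: Psi_inj; rewrite psiK.
have psiD u w : psi (u + w) = psi u + psi w.
  by apply: Psi_inj; rewrite PsiD !psiK.
pose actT (a : prod_qpoly f_) u := Psi (a * psi u).
have sTA a b u : actT a (actT b u) = actT (a * b) u.
  by rewrite /actT PsiK mulrA.
have sT1 u : actT 1 u = u by rewrite /actT mul1r psiK.
have sTDr a u w : actT a (u + w) = actT a u + actT a w.
  by rewrite /actT psiD mulrDr PsiD.
have sTDl a b u : actT (a + b) u = actT a u + actT b u.
  by rewrite /actT mulrDl PsiD.
have act_bij : bijective (fun a => actT a (Psi 1)).
  have act1E a : actT a (Psi 1) = Psi a by rewrite /actT PsiK mulr1.
  by exists psi => [a|u]; rewrite act1E ?PsiK ?psiK.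
pose sT := ModuleStructure sTA sT1 sTDr sTDl.
pose actA (a : {poly %/ f}) u := actT (to_prod_qpoly f_ a) u.
have sAA a b u : actA a (actA b u) = actA (a * b) u.
  by rewrite /actA sTA (to_prod_qpolyM f_mon fprod).
have sA1 u : actA 1 u = u by rewrite /actA (to_prod_qpoly1 f_mon fprod).
have sADl a b u : actA (a + b) u = actA a u + actA b u.
  by rewrite /actA (to_prod_qpolyD f_mon fprod).
exists (ModuleStructure sAA sA1 (fun a => sTDr _) sADl); split.
- move=> c u; rewrite /= /actA /actT (to_prod_qpolyC f_mon fprod) PsiM mxevC.
  by rewrite mul_mx_scalar /phi lincombZ -/phi -/(Psi _) psiK.
- move=> u; rewrite /= /actA /actT (to_prod_in_qpoly f_mon fprod) PsiM mxevX.
  by rewrite -phiN -/(Psi _) psiK.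
exists sT; split; first by [].
exact: (ex_intro _ (Psi 1) act_bij).
Qed.
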